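(* Let $\Lambda$ be a row-finite $k$-graph with no sources. Then the Boolean algebras $\operatorname{Reg}(T_\Lambda)$ and $\operatorname{Reg}^{\mathrm{gr}}(\operatorname{KP}(\Lambda))$ are isomorphic via the isomorphism sending $J$ in $\operatorname{Reg}(T_\Lambda)$ to $I(H_J)$ in $\operatorname{Reg}^{\mathrm{gr}}(\operatorname{KP}(\Lambda))$. Consequently, if $\Lambda$ and $\Omega$ are row-finite $k$-graphs without sources such that $T_\Lambda\cong T_\Omega$ as $\mathbb Z^k$-monoids, then $\operatorname{Reg}^{\mathrm{gr}}(\operatorname{KP}(\Lambda))$ is isomorphic to $\operatorname{Reg}^{\mathrm{gr}}(\operatorname{KP}(\Omega))$.
   Context: $k\ge1$ is an integer, $\mathbb N\ni0$. A $k$-graph is a countable small category $\Lambda$ with a functor $d:\Lambda\to\mathbb N^k$ such that whenever $d(\lambda)=\mathbf m+\mathbf n$ there are unique $\alpha,\beta$ with $d(\alpha)=\mathbf m$, $d(\beta)=\mathbf n$, $\lambda=\alpha\beta$. Objects are identified with $\Lambda^0=d^{-1}(0)$; $r,s$ denote codomain and domain; $v\Lambda^{\mathbf n}=\{\lambda: d(\lambda)=\mathbf n,\ r(\lambda)=v\}$. $\Lambda$ is row-finite if every $v\Lambda^{\mathbf n}$ is finite, and without sources if every $v\Lambda^{\mathbf n}$ is nonempty. The talented monoid $T_\Lambda$ is the commutative monoid generated by $v(\mathbf n)$ ($v\in\Lambda^0$, $\mathbf n\in\mathbb Z^k$) subject to $v(\mathbf n)=\sum_{\alpha\in v\Lambda^{\mathbf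 m}}s(\alpha)(\mathbf n+\mathbf m)$ for $v\in\Lambda^0,\mathbf n\in\mathbb Z^k,\mathbf m\in\mathbb N^k$, with $\mathbb Z^k$ acting by ${}^{\mathbf q}v(\mathbf n)=v(\mathbf n+\mathbf q)$; isomorphisms of $\mathbb Z^k$-monoids are equivariant monoid isomorphisms. $x\le y$ iff $y=x+z$ for some $z$; $x\parallel y$ means $x\nleq y$ and $y\nleq x$. A $\mathbb Z^k$-order ideal is a submonoid that is a down-set for $\le$ and closed under $\mathbb Z^k$. For a $\mathbb Z^k$-order ideal $J$, $H_J:=\{v\in\Lambda^0:v(0)\in J\}$, and $J^\perp:=\{x: x\parallel a\text{ for all }0\ne a\in J\}\cup\{0\}$, which is again a $\mathbb Z^k$-order ideal; $J$ is regular if $J=(J^\perp)^\perp$. $\operatorname{Reg}(T_\Lambda)$ is the set of regular $\mathbb Z^k$-order ideals ordered by inclusion (a complete Boolean algebra). $\operatorname{KP}(\Lambda)$ is the universal associative algebra over a fixed arbitrary field generated by $p_v$ ($v\in\Lambda^0$), $s_\lambda,s_{\lambda^*}$ ($\lambda\in\Lambda\setminus\Lambda^0$) subject to: $p_up_v=\delta_{u,v}p_u$; $s_\lambda s_\mu=s_{\lambda\mu}$, $s_{\mu^*}s_{\lambda^*}=s_{(\lambda\mu)^*}$ when $s(\lambda)=r(\mu)$; $p_{r(\lambda)}s_\lambda=s_\lambda=s_\lambda p_{s(\lambda)}$, $p_{s(\lambda)}s_{\lambda^*}=s_{\lambda^*}=s_{\lambda^*}p_{r(\lambda)}$; $s_{\lambda^*}s_\mu=\delta_{\lambda,\mu}p_{s(\lambda)}$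 when $d(\lambda)=d(\mu)$; $p_v=\sum_{\lambda\in v\Lambda^{\mathbf n}}s_\lambda s_{\lambda^*}$ for $\mathbf n\ne0$. It is $\mathbb Z^k$-graded with $p_v$, $s_\lambda$, $s_{\lambda^*}$ of degrees $0$, $d(\lambda)$, $-d(\lambda)$; a graded ideal $I$ satisfies $I=\bigoplus_{\mathbf n}(I\cap R_{\mathbf n})$. For $H\subseteq\Lambda^0$, $I(H)$ is the ideal generated by $\{p_v:v\in H\}$. For an ideal $I$ of an algebra $A$, $I^\perp:=\{x\in A: xa=ax=0\text{ for all }a\in I\}$; $I$ is regular if $I=(I^\perp)^\perp$. $\operatorname{Reg}^{\mathrm{gr}}(\operatorname{KP}(\Lambda))$ is the set of regular graded ideals ordered by inclusion (a Boolean algebra). *)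

(* Defs.v *)
From HB Require Import structures.
From mathcomp Require Import all_boot all_order all_algebra.
From mathcomp Require Import boolp classical_sets functions cardinality.

Set Implicit Arguments.
Unset Strict Implicit.
Unset Printing Implicit Defensive.

Import GRing.Theory.
Local Open Scope classical_set_scope.
Local Open Scope ring_scope.
Local Open Scope quotient_scope.

(* [kcomp a b] is the composite path ab; it is constrained only when
   [ksrc a = krng b].  By the factorization property the morphisms of degree 0
   are exactly the identities [kid v], so that [kvertex] is the set of objects
   identified with d^-1(0).  Countability of the category is carried by
   [countType]. *)
Record kgraph (k : nat) := KGraph {
  kvertex : countType;
  kpath : countType;
  krng : kpath -> kvertex;
  ksrc : kpath -> kvertex;
  kid : kvertex -> kpath;
  kcomp : kpath -> kpath -> kpath;
  kdeg : kpath -> 'rV[nat]_k;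
  krng_id : forall v, krng (kid v) = v;
  ksrc_id : forall v, ksrc (kid v) = v;
  krng_comp : forall a b, ksrc a = krng b -> krng (kcomp a b) = krng a;
  ksrc_comp : forall a b, ksrc a = krng b -> ksrc (kcomp a b) = ksrc b;
  kcomp_idl : forall a, kcomp (kid (krng a)) a = a;
  kcomp_idr : forall a, kcomp a (kid (ksrc a)) = a;
  kcompA : forall a b c, ksrc a = krng b -> ksrc b = krng c ->
    kcomp a (kcomp b c) = kcomp (kcomp a b) c;
  kdeg_id : forall v, kdeg (kid v) = 0;
  kdeg_comp : forall a b, ksrc a = krng b ->
    kdeg (kcomp a b) = kdeg a + kdeg b;
  kfactorization : forall a (m n : 'rV[nat]_k), kdeg a = m + n ->
    exists! bc : kpath * kpath,
      [/\ kdeg bc.1 = m, kdeg bc.2 = n, ksrc bc.1 = krng bc.2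
        & a = kcomp bc.1 bc.2]
}.

Definition paths_from k (L : kgraph k) (v : kvertex L) (n : 'rV[nat]_k) :
  set (kpath L) := [set a | krng a = v /\ kdeg a = n].

Definition row_finite k (L : kgraph k) : Prop :=
  forall (v : kvertex L) n, finite_set (paths_from v n).

Definition without_sources k (L : kgraph k) : Prop :=
  forall (v : kvertex L) n, paths_from v n !=set0.

Definition degZ k (n : 'rV[nat]_k) : 'rV[int]_k := map_mx Posz n.

Definition enumerates (T : eqType) (s : seq T) (A : set T) : Prop :=
  uniq s /\ (forall a, a \in s <-> A a).

Record zmonoid (k : nat) := ZMonoid {
  zm_sort :> nmodType;
  zm_act : 'rV[int]_k -> zm_sort -> zm_sort;
  zm_act0 : forall x, zm_act 0 x = x;
  zm_actD : forall p q x, zm_act (p + q) x = zm_act p (zm_act q x);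
  zm_act_add : forall q x y, zm_act q (x + y) = zm_act q x + zm_act q y;
  zm_act_zero : forall q, zm_act q 0 = 0
}.

Definition zmonoid_iso k (M N : zmonoid k) : Prop :=
  exists f : M -> N,
    [/\ bijective f, f 0 = 0, forall x y, f (x + y) = f x + f y
      & forall q x, f (zm_act q x) = zm_act q (f x)].

Definition alg_le (M : nmodType) (x y : M) : Prop := exists z, y = x + z.

Definition incomparable (M : nmodType) (x y : M) : Prop :=
  ~ alg_le x y /\ ~ alg_le y x.

Record zorder_ideal k (M : zmonoid k) (J : set M) : Prop := ZOrderIdeal {
  zoi_zero : J 0;
  zoi_add : forall x y, J x -> J y -> J (x + y);
  zoi_down : forall x y, alg_le x y -> J y -> J x;
  zoi_act : forall q x, J x -> J (zm_act q x)
}.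

Definition zperp (M : nmodType) (J : set M) : set M :=
  [set x | forall a, J a -> a <> 0 -> incomparable x a] `|` [set 0].

Definition RegZ k (M : zmonoid k) : set (set M) :=
  [set J | zorder_ideal J /\ J = zperp (zperp J)].

Arguments RegZ {k} M _.

(* The monoid presented by generators and relations is the quotient of the
   formal sums of generators by the least congruence containing the laws of
   commutative monoids and the defining relations. *)
Section TalentedMonoid.
Variables (k : nat) (L : kgraph k).

Inductive tterm : Type :=
  | TGen of kvertex L & 'rV[int]_k
  | TZero
  | TAdd of tterm & tterm.

Inductive teq : tterm -> tterm -> Prop :=
  | teq_refl x : teq x x
  | teq_sym x y : teq x y -> teq y x
  | teq_trans x y z : teq x y -> teq y z -> teq x z
  | teq_add x x' y y' : teq x x' -> teq y y' -> teq (TAdd x y) (TAdd x' y')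
  | teq_addA x y z : teq (TAdd x (TAdd y z)) (TAdd (TAdd x y) z)
  | teq_addC x y : teq (TAdd x y) (TAdd y x)
  | teq_add0 x : teq (TAdd TZero x) x
  | teq_rel v (n : 'rV[int]_k) (m : 'rV[nat]_k) (s : seq (kpath L)) :
      enumerates s (paths_from v m) ->
      teq (TGen v n)
          (foldr TAdd TZero [seq TGen (ksrc a) (n + degZ m) | a <- s]).

HB.instance Definition _ := gen_eqMixin tterm.
HB.instance Definition _ := gen_choiceMixin tterm.

Definition teqb (x y : tterm) : bool := `[< teq x y >].

Lemma teqb_equiv : equiv_class_of teqb.
Proof.
split=> [x|x y|y x z].
- exact/asboolP/teq_refl.
- by apply/asboolP/asboolP => /teq_sym.
- by move=> /asboolP xy /asboolP yz; apply/asboolP; exact: teq_trans yz.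
Qed.

Canonical teqb_equiv_rel := EquivRelPack teqb_equiv.

Definition tmon := {eq_quot teqb_equiv_rel}.
HB.instance Definition _ := Choice.on tmon.

Definition tpi (x : tterm) : tmon := \pi_tmon x.

Lemma tpiP x y : tpi x = tpi y <-> teq x y.
Proof.
by split=> [/eqmodP/asboolP|/asboolP xy] //; apply/eqmodP.
Qed.

Lemma teq_repr x : teq (repr (tpi x)) x.
Proof. by apply/tpiP; rewrite /tpi reprK. Qed.

Lemma tpi_repr (x : tmon) : tpi (repr x) = x.
Proof. exact: reprK. Qed.

Definition tmon_zero : tmon := tpi TZero.
Definition tmon_add (x y : tmon) : tmon := tpi (TAdd (repr x) (repr y)).

Lemma tpi_add x y : tmon_add (tpi x) (tpi y) = tpi (TAdd x y).
Proof. by apply/tpiP/teq_add; apply: teq_repr. Qed.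

Lemma tmon_addA : associative tmon_add.
Proof.
move=> x y z; rewrite -[x]tpi_repr -[y]tpi_repr -[z]tpi_repr !tpi_add.
exact/tpiP/teq_addA.
Qed.

Lemma tmon_addC : commutative tmon_add.
Proof. by move=> x y; apply/tpiP/teq_addC. Qed.

Lemma tmon_add0 : left_id tmon_zero tmon_add.
Proof.
by move=> x; rewrite -[x]tpi_repr tpi_add; apply/tpiP/teq_add0.
Qed.

HB.instance Definition _ :=
  GRing.isNmodule.Build tmon tmon_addA tmon_addC tmon_add0.

Fixpoint tterm_act (q : 'rV[int]_k) (x : tterm) : tterm :=
  match x with
  | TGen v n => TGen v (n + q)
  | TZero => TZero
  | TAdd y z => TAdd (tterm_act q y) (tterm_act q z)
  end.

Lemma teq_act q x y : teq x y -> teq (tterm_act q x) (tterm_act q y).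
Proof.
elim=> {x y} [x|x y _|x y z _ xy _|x x' y y' _ xx' _ yy'|x y z|x y|x
             |v n m s sP] /=.
- exact: teq_refl.
- exact: teq_sym.
- exact: teq_trans xy.
- exact: teq_add.
- exact: teq_addA.
- exact: teq_addC.
- exact: teq_add0.
- suff -> : tterm_act q
      (foldr TAdd TZero [seq TGen (ksrc a) (n + degZ m) | a <- s]) =
      foldr TAdd TZero [seq TGen (ksrc a) (n + q + degZ m) | a <- s].
    exact: teq_rel.
  by elim: s {sP} => //= a s ->; rewrite addrAC.
Qed.

Definition tmon_act (q : 'rV[int]_k) (x : tmon) : tmon :=
  tpi (tterm_act q (repr x)).

Lemma tpi_act q x : tmon_act q (tpi x) = tpi (tterm_act q x).
Proof. exact/tpiP/teq_act/teq_repr. Qed.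

Lemma tmon_act0 x : tmon_act 0 x = x.
Proof.
rewrite -[x]tpi_repr tpi_act; congr tpi.
by elim: (repr x) => [v n||y IHy z IHz] //=; rewrite ?addr0 ?IHy ?IHz.
Qed.

Lemma tmon_actD p q x : tmon_act (p + q) x = tmon_act p (tmon_act q x).
Proof.
rewrite -[x]tpi_repr !tpi_act; congr tpi.
elim: (repr x) => [v n||y IHy z IHz] //=; rewrite ?IHy ?IHz //.
by rewrite [p + q]addrC addrA.
Qed.

Lemma tmon_act_add q (x y : tmon) :
  tmon_act q (x + y) = tmon_act q x + tmon_act q y.
Proof.
rewrite -[x]tpi_repr -[y]tpi_repr.
have addE u w : tpi u + tpi w = tpi (TAdd u w) := tpi_add u w.
by rewrite addE !tpi_act addE.
Qed.

Lemma tmon_act_zero q : tmon_act q 0 = 0.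
Proof. by rewrite -[0]/(tpi TZero) tpi_act. Qed.

Definition talented_monoid : zmonoid k :=
  ZMonoid tmon_act0 tmon_actD tmon_act_add tmon_act_zero.

Definition tgen (v : kvertex L) (n : 'rV[int]_k) : talented_monoid :=
  tpi (TGen v n).

Definition hvertices (J : set talented_monoid) : set (kvertex L) :=
  [set v | J (tgen v 0)].

End TalentedMonoid.

Record nualg (F : fieldType) := NUAlg {
  nu_sort :> lmodType F;
  nu_mul : nu_sort -> nu_sort -> nu_sort;
  nu_mulA : associative nu_mul;
  nu_mulDl : left_distributive nu_mul +%R;
  nu_mulDr : right_distributive nu_mul +%R;
  nu_scaleAl : forall c x y, c *: nu_mul x y = nu_mul (c *: x) y;
  nu_scaleAr : forall c x y, c *: nu_mul x y = nu_mul x (c *: y)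
}.

Record nuideal (F : fieldType) (A : nualg F) (I : set A) : Prop := NUIdeal {
  nui_zero : I 0;
  nui_add : forall x y, I x -> I y -> I (x + y);
  nui_scale : forall (c : F) x, I x -> I (c *: x);
  nui_mull : forall a x, I x -> I (nu_mul a x);
  nui_mulr : forall a x, I x -> I (nu_mul x a)
}.

Definition ideal_gen (F : fieldType) (A : nualg F) (S : set A) : set A :=
  [set x | forall I : set A, nuideal I -> S `<=` I -> I x].

Definition annihilator (F : fieldType) (A : nualg F) (I : set A) : set A :=
  [set x | forall a, I a -> nu_mul x a = 0 /\ nu_mul a x = 0].

(* [I] is the internal direct sum of the sets [I `&` C n], where [C n] is the
   homogeneous component of degree [n]. *)
Definition graded_by (F : fieldType) (A : nualg F) k
    (C : 'rV[int]_k -> set A) (I : set A) : Prop :=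
  (forall x, I x <-> exists (s : seq 'rV[int]_k) (y : 'rV[int]_k -> A),
     [/\ uniq s, forall n, n \in s -> (I `&` C n) (y n)
       & x = \sum_(n <- s) y n]) /\
  (forall (s : seq 'rV[int]_k) (y : 'rV[int]_k -> A),
     uniq s -> (forall n, n \in s -> (I `&` C n) (y n)) ->
     \sum_(n <- s) y n = 0 -> forall n, n \in s -> y n = 0).

Section KumjianPask.
Variables (F : fieldType) (k : nat) (L : kgraph k).

Definition kppath := {a : kpath L | kdeg a != 0}.

Inductive kterm : Type :=
  | KVertex of kvertex L
  | KPath of kppath
  | KGhost of kppath
  | KZero
  | KOpp of kterm
  | KAdd of kterm & kterm
  | KScale of F & kterm
  | KMul of kterm & kterm.

Inductive keq : kterm -> kterm -> Prop :=
  | keq_refl x : keq x x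
  | keq_sym x y : keq x y -> keq y x
  | keq_trans x y z : keq x y -> keq y z -> keq x z
  | keq_opp x x' : keq x x' -> keq (KOpp x) (KOpp x')
  | keq_add x x' y y' : keq x x' -> keq y y' -> keq (KAdd x y) (KAdd x' y')
  | keq_scale c x x' : keq x x' -> keq (KScale c x) (KScale c x')
  | keq_mul x x' y y' : keq x x' -> keq y y' -> keq (KMul x y) (KMul x' y')
  | keq_addA x y z : keq (KAdd x (KAdd y z)) (KAdd (KAdd x y) z)
  | keq_addC x y : keq (KAdd x y) (KAdd y x)
  | keq_add0 x : keq (KAdd KZero x) x
  | keq_addN x : keq (KAdd (KOpp x) x) KZero
  | keq_scaleA c d x : keq (KScale c (KScale d x)) (KScale (c * d) x)
  | keq_scale1 x : keq (KScale 1 x) x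
  | keq_scaleDr c x y :
      keq (KScale c (KAdd x y)) (KAdd (KScale c x) (KScale c y))
  | keq_scaleDl c d x :
      keq (KScale (c + d) x) (KAdd (KScale c x) (KScale d x))
  | keq_mulA x y z : keq (KMul x (KMul y z)) (KMul (KMul x y) z)
  | keq_mulDl x y z : keq (KMul (KAdd x y) z) (KAdd (KMul x z) (KMul y z))
  | keq_mulDr x y z : keq (KMul x (KAdd y z)) (KAdd (KMul x y) (KMul x z))
  | keq_scaleAl c x y : keq (KScale c (KMul x y)) (KMul (KScale c x) y)
  | keq_scaleAr c x y : keq (KScale c (KMul x y)) (KMul x (KScale c y))
  | keq_pp v : keq (KMul (KVertex v) (KVertex v)) (KVertex v)
  | keq_pp0 u v : u <> v -> keq (KMul (KVertex u) (KVertex v)) KZero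
  | keq_ss (a b c : kppath) :
      ksrc (val a) = krng (val b) -> val c = kcomp (val a) (val b) ->
      keq (KMul (KPath a) (KPath b)) (KPath c)
  | keq_gg (a b c : kppath) :
      ksrc (val a) = krng (val b) -> val c = kcomp (val a) (val b) ->
      keq (KMul (KGhost b) (KGhost a)) (KGhost c)
  | keq_ps (a : kppath) :
      keq (KMul (KVertex (krng (val a))) (KPath a)) (KPath a)
  | keq_sp (a : kppath) :
      keq (KMul (KPath a) (KVertex (ksrc (val a)))) (KPath a)
  | keq_pg (a : kppath) :
      keq (KMul (KVertex (ksrc (val a))) (KGhost a)) (KGhost a)
  | keq_gp (a : kppath) :
      keq (KMul (KGhost a) (KVertex (krng (val a)))) (KGhost a)
  | keq_gs (a : kppath) :
      keq (KMul (KGhost a) (KPath a)) (KVertex (ksrc (val a)))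
  | keq_gs0 (a b : kppath) : kdeg (val a) = kdeg (val b) -> a <> b ->
      keq (KMul (KGhost a) (KPath b)) KZero
  | keq_sum v (n : 'rV[nat]_k) (s : seq kppath) : n <> 0 ->
      enumerates [seq val a | a <- s] (paths_from v n) ->
      keq (KVertex v)
          (foldr KAdd KZero [seq KMul (KPath a) (KGhost a) | a <- s]).

HB.instance Definition _ := gen_eqMixin kterm.
HB.instance Definition _ := gen_choiceMixin kterm.

Definition keqb (x y : kterm) : bool := `[< keq x y >].

Lemma keqb_equiv : equiv_class_of keqb.
Proof.
split=> [x|x y|y x z].
- exact/asboolP/keq_refl.
- by apply/asboolP/asboolP => /keq_sym.
- by move=> /asboolP xy /asboolP yz; apply/asboolP; exact: keq_trans yz.
Qed.

Canonical keqb_equiv_rel := EquivRelPack keqb_equiv.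

Definition kpq := {eq_quot keqb_equiv_rel}.
HB.instance Definition _ := Choice.on kpq.

Definition kpi (x : kterm) : kpq := \pi_kpq x.

Lemma kpiP x y : kpi x = kpi y <-> keq x y.
Proof.
by split=> [/eqmodP/asboolP|/asboolP xy] //; apply/eqmodP.
Qed.

Lemma keq_repr x : keq (repr (kpi x)) x.
Proof. by apply/kpiP; rewrite /kpi reprK. Qed.

Lemma kpi_repr (x : kpq) : kpi (repr x) = x.
Proof. exact: reprK. Qed.

Definition kpq_zero : kpq := kpi KZero.
Definition kpq_opp (x : kpq) : kpq := kpi (KOpp (repr x)).
Definition kpq_add (x y : kpq) : kpq := kpi (KAdd (repr x) (repr y)).
Definition kpq_scale (c : F) (x : kpq) : kpq := kpi (KScale c (repr x)).
Definition kpq_mul (x y : kpq) : kpq := kpi (KMul (repr x) (repr y)).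

Lemma kpi_opp x : kpq_opp (kpi x) = kpi (KOpp x).
Proof. exact/kpiP/keq_opp/keq_repr. Qed.

Lemma kpi_add x y : kpq_add (kpi x) (kpi y) = kpi (KAdd x y).
Proof. by apply/kpiP/keq_add; apply: keq_repr. Qed.

Lemma kpi_scale c x : kpq_scale c (kpi x) = kpi (KScale c x).
Proof. exact/kpiP/keq_scale/keq_repr. Qed.

Lemma kpi_mul x y : kpq_mul (kpi x) (kpi y) = kpi (KMul x y).
Proof. by apply/kpiP/keq_mul; apply: keq_repr. Qed.

Lemma kpq_addA : associative kpq_add.
Proof.
move=> x y z; rewrite -[x]kpi_repr -[y]kpi_repr -[z]kpi_repr !kpi_add.
exact/kpiP/keq_addA.
Qed.

Lemma kpq_addC : commutative kpq_add.
Proof. by move=> x y; apply/kpiP/keq_addC. Qed.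

Lemma kpq_add0 : left_id kpq_zero kpq_add.
Proof. by move=> x; rewrite -[x]kpi_repr kpi_add; apply/kpiP/keq_add0. Qed.

Lemma kpq_addN : left_inverse kpq_zero kpq_opp kpq_add.
Proof.
by move=> x; rewrite -[x]kpi_repr kpi_opp kpi_add; apply/kpiP/keq_addN.
Qed.

HB.instance Definition _ :=
  GRing.isZmodule.Build kpq kpq_addA kpq_addC kpq_add0 kpq_addN.

Lemma kpi_addE x y : kpi x + kpi y = kpi (KAdd x y).
Proof. exact: kpi_add. Qed.

Lemma kpq_scaleA c d x : kpq_scale c (kpq_scale d x) = kpq_scale (c * d) x.
Proof. by rewrite -[x]kpi_repr !kpi_scale; apply/kpiP/keq_scaleA. Qed.

Lemma kpq_scale1 : left_id 1 kpq_scale.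
Proof. by move=> x; rewrite -[x]kpi_repr kpi_scale; apply/kpiP/keq_scale1. Qed.

Lemma kpq_scaleDr : right_distributive kpq_scale +%R.
Proof.
move=> c x y; rewrite -[x]kpi_repr -[y]kpi_repr !(kpi_addE, kpi_scale).
exact/kpiP/keq_scaleDr.
Qed.

Lemma kpq_scaleDl x : {morph kpq_scale^~ x : c d / c + d}.
Proof.
move=> c d; rewrite -[x]kpi_repr !(kpi_addE, kpi_scale).
exact/kpiP/keq_scaleDl.
Qed.

HB.instance Definition _ := GRing.Zmodule_isLmodule.Build F kpq
  kpq_scaleA kpq_scale1 kpq_scaleDr kpq_scaleDl.

Lemma kpi_scaleE c x : c *: kpi x = kpi (KScale c x).
Proof. exact: kpi_scale. Qed.

Lemma kpq_mulA : associative kpq_mul.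
Proof.
move=> x y z; rewrite -[x]kpi_repr -[y]kpi_repr -[z]kpi_repr !kpi_mul.
exact/kpiP/keq_mulA.
Qed.

Lemma kpq_mulDl : left_distributive kpq_mul +%R.
Proof.
move=> x y z; rewrite -[x]kpi_repr -[y]kpi_repr -[z]kpi_repr.
by rewrite !(kpi_addE, kpi_mul); apply/kpiP/keq_mulDl.
Qed.

Lemma kpq_mulDr : right_distributive kpq_mul +%R.
Proof.
move=> x y z; rewrite -[x]kpi_repr -[y]kpi_repr -[z]kpi_repr.
by rewrite !(kpi_addE, kpi_mul); apply/kpiP/keq_mulDr.
Qed.

Lemma kpq_scaleAl c (x y : kpq) : c *: kpq_mul x y = kpq_mul (c *: x) y.
Proof.
rewrite -[x]kpi_repr -[y]kpi_repr !(kpi_scaleE, kpi_mul).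
exact/kpiP/keq_scaleAl.
Qed.

Lemma kpq_scaleAr c (x y : kpq) : c *: kpq_mul x y = kpq_mul x (c *: y).
Proof.
rewrite -[x]kpi_repr -[y]kpi_repr !(kpi_scaleE, kpi_mul).
exact/kpiP/keq_scaleAr.
Qed.

Definition KP : nualg F :=
  NUAlg kpq_mulA kpq_mulDl kpq_mulDr kpq_scaleAl kpq_scaleAr.

Definition kp_vertex (v : kvertex L) : KP := kpi (KVertex v).
Definition kp_path (a : kppath) : KP := kpi (KPath a).
Definition kp_ghost (a : kppath) : KP := kpi (KGhost a).

(* The homogeneous components of KP: the least subspaces containing the
   generators in their degrees and compatible with the product. *)
Inductive kp_homog : 'rV[int]_k -> KP -> Prop :=
  | kph_vertex v : kp_homog 0 (kp_vertex v)
  | kph_path (a : kppath) : kp_homog (degZ (kdeg (val a))) (kp_path a)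
  | kph_ghost (a : kppath) : kp_homog (- degZ (kdeg (val a))) (kp_ghost a)
  | kph_zero n : kp_homog n 0
  | kph_add n x y : kp_homog n x -> kp_homog n y -> kp_homog n (x + y)
  | kph_scale n c x : kp_homog n x -> kp_homog n (c *: x)
  | kph_mul m n x y :
      kp_homog m x -> kp_homog n y -> kp_homog (m + n) (nu_mul x y).

Definition vertex_ideal (H : set (kvertex L)) : set KP :=
  ideal_gen [set kp_vertex v | v in H].

Definition RegGr : set (set KP) :=
  [set I | [/\ nuideal I, graded_by kp_homog I
             & I = annihilator (annihilator I)]].

End KumjianPask.

Arguments vertex_ideal F {k L} H _.
Arguments RegGr F {k} L _.

Record boolean_operations T (X : set (set T)) (bot top : set T)
    (compl : set T -> set T) (meet join : set T -> set T -> set T) : Prop :=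
BooleanOperations {
  bo_bot : X bot /\ (forall A, X A -> bot `<=` A);
  bo_top : X top /\ (forall A, X A -> A `<=` top);
  bo_meet : forall A B, X A -> X B -> X (meet A B) /\
    (forall C, X C -> (C `<=` meet A B <-> C `<=` A /\ C `<=` B));
  bo_join : forall A B, X A -> X B -> X (join A B) /\
    (forall C, X C -> (join A B `<=` C <-> A `<=` C /\ B `<=` C));
  bo_distr : forall A B C, X A -> X B -> X C ->
    meet A (join B C) = join (meet A B) (meet A C);
  bo_compl : forall A, X A ->
    [/\ X (compl A), meet A (compl A) = bot & join A (compl A) = top]
}.

Definition boolean_algebra T (X : set (set T)) : Prop :=
  exists bot top compl meet join,
    boolean_operations X bot top compl meet join.

(* The Boolean operations are determined by the order, so isomorphisms of
   Boolean algebras are the order isomorphisms. *)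
Definition boolean_iso T U (X : set (set T)) (Y : set (set U))
    (f : set T -> set U) : Prop :=
  [/\ boolean_algebra X, boolean_algebra Y, set_bij X Y f
    & forall A B, X A -> X B -> (A `<=` B <-> f A `<=` f B)].

(* Main.v *)
(* Both lattices of regular ideals are identified with the lattice of sets H of
   vertices such that H = H^pp, where H^p consists of the vertices from which no
   path leads into H.
   On the monoid side, the support of a formal sum either lies in a hereditary
   saturated H for all representatives of a class or for none, so that order ideals
   correspond to hereditary saturated sets and J^perp to H^p.
   On the algebra side, cutting a homogeneous x by s_a^* and s_b of large degrees
   yields scalar multiples of vertices; hence graded ideals are generated by their
   vertices, and the annihilator of I(H) is I(H^p).  The only nondegeneracy needed,
   p_v <> 0 and the independence of the homogeneous components, is read off a graded
   representation on functions on infinite paths. *)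
Require Import Defs.
From mathcomp Require Import all_boot all_order all_algebra.
From mathcomp Require Import boolp classical_sets functions cardinality.

Set Implicit Arguments.
Unset Strict Implicit.
Unset Printing Implicit Defensive.

Import GRing.Theory.
Local Open Scope classical_set_scope.
Local Open Scope ring_scope.

(** The Boolean axioms are checked once, on the regular vertex sets, which behave like the regular
    open sets of a topology; both ideal lattices receive them by transport. The algebra is given by
    generators and relations, so nothing in it is visibly nonzero. Infinite paths are a natural
    space to represent it on, because each has exactly one initial segment of every degree, as the
    summation relation demands. Large degrees enter because s_c s_d^* cut by s_a^* on the left and
    s_b on the right, where a has the degree of c and b that of d, leaves a vertex or zero. The
    vertices lying in I(H) are never computed directly. Those lying in its annihilator are, and this
    suffices for regular ideals, so that regularity takes over the role of saturation on the algebra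
    side. *)

Section BooleanIso.

(** * Transport of Boolean structure along order isomorphisms *)

Lemma boolean_transport T U (X : set (set T)) (Y : set (set U))
    (f : set T -> set U) :
  boolean_algebra X -> set_bij X Y f ->
  (forall A B, X A -> X B -> (A `<=` B <-> f A `<=` f B)) ->
  boolean_iso X Y f.
Proof.
move=> XB [fXY finj fsur] fle; split=> //; have [bot [top [compl [meet [join
  [[bX bl] [tX tl] mX jX dX cX]]]]]] := XB.
pose g (B : set U) := xget set0 [set A | X A /\ f A = B].
have gP B : Y B -> X (g B) /\ f (g B) = B.
  move=> /fsur[A XA AB].
  exact: (@xgetPex _ set0 [set A | X A /\ f A = B] (ex_intro _ A (conj XA AB))).
have gX B YB := (gP B YB).1.
have gK B YB := (gP B YB).2.
have fK A : X A -> g (f A) = A.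
  by move=> XA; have [XgA gA] := gP _ (fXY _ XA); apply: finj; rewrite ?inE.
(* Together with [fge']: [f] and [g] are adjoint on both sides, which carries over each universal
   property. *)
have fle' A B : X A -> Y B -> f A `<=` B <-> A `<=` g B.
  by move=> XA YB; rewrite -{1}(gK B YB) -fle//; apply: gX.
have fge' A B : X A -> Y B -> B `<=` f A <-> g B `<=` A.
  by move=> XA YB; rewrite -{1}(gK B YB) -fle//; apply: gX.
exists (f bot), (f top), (f \o compl \o g), (fun A B => f (meet (g A) (g B))),
  (fun A B => f (join (g A) (g B))).
split.
- by split=> [|A YA]; [exact: fXY|exact: (fle' _ _ bX YA).2 (bl _ (gX _ YA))].
- by split=> [|A YA]; [exact: fXY|exact: (fge' _ _ tX YA).2 (tl _ (gX _ YA))].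
- move=> A B YA YB; have [XM lM] := mX _ _ (gX _ YA) (gX _ YB).
  split=> [|C YC]; first exact: fXY.
  rewrite (fge' _ _ XM YC) lM; last exact: gX.
  by rewrite -!fge' ?gK//; exact: gX.
- move=> A B YA YB; have [XM lM] := jX _ _ (gX _ YA) (gX _ YB).
  split=> [|C YC]; first exact: fXY.
  rewrite (fle' _ _ XM YC) lM; last exact: gX.
  by rewrite -!fle' ?gK//; exact: gX.
- move=> A B C YA YB YC.
  have XgA := gX _ YA; have XgB := gX _ YB; have XgC := gX _ YC.
  have [XBC _] := jX _ _ XgB XgC.
  have [XAB _] := mX _ _ XgA XgB; have [XAC _] := mX _ _ XgA XgC.
  by rewrite !fK// dX.
- move=> A YA; have [XC mC jC] := cX _ (gX _ YA).
  by split=> /=; [exact: fXY|rewrite fK// mC|rewrite fK// jC].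
Qed.

(** Lets the inverse be named by a formula; this is how [tideal] is inverted by [hvertices] in the
    end. *)
Lemma boolean_iso_can T U (X : set (set T)) (Y : set (set U)) f g :
  boolean_iso X Y f -> (forall A, X A -> g (f A) = A) -> boolean_iso Y X g.
Proof.
move=> [XB YB [fXY finj fsur] fle] fK.
have gK B : Y B -> X (g B) /\ f (g B) = B.
  by move=> /fsur[A XA <-]; rewrite fK.
split=> //.
- split=> [B /gK[]//|A B|A XA].
  + by rewrite !inE => /gK[_ {2}<-] /gK[_ {2}<-] ->.
  + by exists (f A); [exact: fXY|exact: fK].
- by move=> A B /gK[XA {1}<-] /gK[XB' {1}<-]; rewrite -fle.
Qed.

Lemma boolean_iso_sym T U (X : set (set T)) (Y : set (set U)) f :
  boolean_iso X Y f -> exists g, boolean_iso Y X g.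
Proof.
move=> fiso; have [_ _ [_ finj _] _] := fiso.
exists (fun B => xget set0 [set A | X A /\ f A = B]).
apply: (boolean_iso_can fiso) => A XA.
have [XC CA] := @xgetPex _ set0 [set C | X C /\ f C = f A]
  (ex_intro _ A (conj XA erefl)).
by apply: finj; rewrite ?inE.
Qed.

Lemma boolean_iso_comp T U V (X : set (set T)) (Y : set (set U))
    (Z : set (set V)) f g :
  boolean_iso X Y f -> boolean_iso Y Z g -> boolean_iso X Z (g \o f).
Proof.
move=> [XB YB [fXY finj fsur] fle] [_ ZB [gYZ ginj gsur] gle]; split=> //.
- split.
  + by move=> A XA; exact/gYZ/fXY.
  + move=> A B; rewrite !inE => XA XB' /= E; apply: finj; rewrite ?inE//.
    by apply: ginj E; rewrite inE; exact: fXY.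
  + by move=> C /gsur[B /fsur[A XA <-] <-]; exists A.
- by move=> A B XA XB'; rewrite fle// gle//; exact: fXY.
Qed.

End BooleanIso.

(** * Hereditary, saturated and regular sets of vertices *)

Section Vertices.
Variables (k : nat) (L : kgraph k).

Definition hereditary (H : set (kvertex L)) :=
  forall a : kpath L, H (krng a) -> H (ksrc a).

Definition saturated (H : set (kvertex L)) :=
  forall v m, (forall a, paths_from v m a -> H (ksrc a)) -> H v.

(** Hereditary sets are the open sets of a topology on the vertices; [vperp H] is the interior of
    the complement of H. *)
Definition vperp (H : set (kvertex L)) : set (kvertex L) :=
  [set v | forall a : kpath L, krng a = v -> ~ H (ksrc a)].

Definition RegV : set (set (kvertex L)) := [set H | H = vperp (vperp H)].

Lemma vperp_hereditary H : hereditary (vperp H).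
Proof.
by move=> a ra b rb; rewrite -(ksrc_comp (esym rb)); apply: ra; rewrite krng_comp.
Qed.

Lemma vperp_disjoint H v : H v -> ~ vperp H v.
Proof. by move=> Hv /(_ (kid v)); rewrite krng_id ksrc_id => /(_ erefl). Qed.

Lemma vperpS H K : H `<=` K -> vperp K `<=` vperp H.
Proof. by move=> HK v vK a av /HK; exact: vK. Qed.

Lemma sub_vperp2 H : hereditary H -> H `<=` vperp (vperp H).
Proof. by move=> hH v Hv a av; apply/vperp_disjoint/hH; rewrite av. Qed.

(** The double perp is a density condition: every path starting at v can be prolonged into H. *)
Lemma vperp2P H v : vperp (vperp H) v <->
  forall a : kpath L, krng a = v -> exists2 b, krng b = ksrc a & H (ksrc b).
Proof.
split=> [Hv a av|Hv a av aH].
- by apply: contra_notP (Hv a av) => nb b ba Hb; apply: nb; exists b.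
- by have [b ba] := Hv a av; exact: aH.
Qed.

Lemma vperp_reg H : hereditary H -> RegV (vperp H).
Proof.
move=> hH; apply/seteqP; split.
  by apply: sub_vperp2; exact: vperp_hereditary.
by apply: vperpS; exact: sub_vperp2.
Qed.

Lemma reg_hereditary H : RegV H -> hereditary H.
Proof. by move=> ->; exact: vperp_hereditary. Qed.

Lemma hereditaryU H K : hereditary H -> hereditary K -> hereditary (H `|` K).
Proof. by move=> hH hK a [/hH|/hK]; [left|right]. Qed.

(** The regular open sets of the topology of hereditary sets: meets are intersections, and a union
    has to be regularized by the double perp. *)
Lemma regV_boolean : boolean_algebra RegV.
Proof.
have vperpT : vperp setT = set0.
  by apply/seteqP; split=> v //; exact: vperp_disjoint.
have vperp0 : vperp set0 = setT by apply/seteqP; split=> // v _ a _ [].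
exists set0, setT, vperp, setI, (fun A B => vperp (vperp (A `|` B))).
have jreg A B : RegV A -> RegV B -> RegV (vperp (vperp (A `|` B))).
  by move=> _ _; exact/vperp_reg/vperp_hereditary.
have jle A B C : RegV A -> RegV B -> RegV C ->
    vperp (vperp (A `|` B)) `<=` C <-> A `<=` C /\ B `<=` C.
  move=> rA rB rC; split=> [ABC|[AC BC]]; last first.
    by rewrite rC; do 2!apply: vperpS; rewrite subUset.
  have ABC' : A `|` B `<=` C.
    apply: subset_trans ABC; apply: sub_vperp2.
    by apply: hereditaryU; exact: reg_hereditary.
  by move: ABC'; rewrite subUset.
split.
- by split=> [|A _]; rewrite /RegV /= ?vperp0 ?vperpT.
- by split=> [|A _]; rewrite /RegV /= ?vperpT ?vperp0.
- move=> A B rA rB; split=> [|C _]; last by rewrite subsetI.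
  apply/seteqP; split.
    by apply: sub_vperp2 => a [Aa Ba]; split; apply: reg_hereditary.
  by rewrite subsetI {2}rA {3}rB; split; do 2!apply: vperpS; move=> v [].
- by move=> A B rA rB; split=> [|C rC]; [exact: jreg|exact: jle].
- move=> A B C rA rB rC; apply/seteqP; split=> v.
  (* The prolongation of a into B or C stays in A by heredity, hence reaches one of the two
     intersections. *)
  + move=> [Av /vperp2P BC]; apply/vperp2P => a av.
    have [b ba bBC] := BC a av; exists b => //.
    have Ab : A (ksrc b).
      by apply: (reg_hereditary rA); rewrite ba; apply: (reg_hereditary rA); rewrite av.
    by case: bBC; [left|right].
  + move=> /vperp2P ABC; split.
      by rewrite rA; apply/vperp2P => a /ABC[b ba [] []]; exists b.
    by apply/vperp2P => a /ABC[b ba [] []]; exists b => //; [left|right].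
- move=> A rA; split.
  + by apply: vperp_reg; exact: reg_hereditary.
  + by apply/seteqP; split=> v // [] /vperp_disjoint.
  + apply/seteqP; split=> v // _; apply/vperp2P => a _.
    have [Aa|nA] := pselect (vperp A (ksrc a)).
      by exists (kid (ksrc a)); rewrite ?krng_id ?ksrc_id//; right.
    apply: contra_notP nA => nA b ba Ab.
    by apply: nA; exists b => //; left.
Qed.

Lemma factor (a : kpath L) m n : kdeg a = m + n -> exists b c : kpath L,
  [/\ kdeg b = m, kdeg c = n, ksrc b = krng c & a = kcomp b c].
Proof. by case/(@kfactorization k L a m n) => -[b c] [bc _]; exists b, c. Qed.

(** Unique factorization as a cancellation law: equal degrees on the left force equal degrees on the
    right, by cancelling entrywise in [nat]. *)
Lemma kcomp_inj (a b a' b' : kpath L) : ksrc a = krng b -> ksrc a' = krng b' ->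
  kdeg a = kdeg a' -> kcomp a b = kcomp a' b' -> a = a' /\ b = b'.
Proof.
move=> ab ab' da E; have dE := kdeg_comp ab; have dE' := kdeg_comp ab'.
have db : kdeg b' = kdeg b.
  move: dE'; rewrite -E dE -da => /matrixP db; apply/matrixP => i j.
  by move: (db i j); rewrite !mxE => /addnI.
have [[x y] [_ u]] := kfactorization dE.
have := u (a', b'); rewrite /= -da db E => /(_ (And4 erefl erefl ab' erefl)).
by have := u (a, b); rewrite /= E => /(_ (And4 erefl erefl ab erefl)) -> [].
Qed.

Hypotheses (rf : row_finite L) (ns : without_sources L).

Lemma vperp_saturated H : hereditary H -> saturated (vperp H).
Proof.
move=> hH v m vm b bv Hb.
have [c [cb cm]] := ns (ksrc b) m.
have bc : ksrc b = krng c by rewrite cb.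
have dbc : kdeg (kcomp b c) = m + kdeg b by rewrite kdeg_comp// cm addrC.
have [a [d [am _ ad E]]] := factor dbc.
have /vperp_hereditary : vperp H (krng d).
  by rewrite -ad; apply: vm; split=> //; rewrite -(krng_comp ad) -E krng_comp.
rewrite -(ksrc_comp ad) -E ksrc_comp//; apply: vperp_disjoint.
by apply: hH; rewrite cb.
Qed.

Lemma reg_saturated H : RegV H -> saturated H.
Proof. by move=> ->; apply: vperp_saturated; exact: vperp_hereditary. Qed.

Lemma enum_paths (v : kvertex L) n : exists s, enumerates s (paths_from v n).
Proof.
have /finite_seqP[s ->] := rf v n.
by exists (undup s); split=> [|a]; rewrite ?undup_uniq ?mem_undup.
Qed.

(** * Order ideals of the talented monoid *)

Local Notation T := (talented_monoid L).

Fixpoint tsupp (H : set (kvertex L)) (t : tterm L) : Prop :=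
  match t with
  | TGen v _ => H v
  | TZero => True
  | TAdd x y => tsupp H x /\ tsupp H y
  end.

Lemma tsupp_foldr H n (s : seq (kpath L)) :
  tsupp H (foldr (@TAdd k L) (@TZero k L) [seq TGen (ksrc a) n | a <- s]) <->
  forall a, a \in s -> H (ksrc a).
Proof.
elim: s => //= a s ->; split=> [[Ha Hs] b|Hs].
  by rewrite inE => /predU1P[->|/Hs].
by split=> [|b bs]; apply: Hs; rewrite inE ?eqxx ?bs ?orbT.
Qed.

(** Only the defining relation has content: heredity carries the support from v to the sum,
    saturation back from the sum to v. *)
Lemma tsupp_teq H : hereditary H -> saturated H ->
  forall t u, teq t u -> (tsupp H t <-> tsupp H u).
Proof.
move=> hH sH t u; elim=> //=; try by move=> *; tauto.
move=> v n m s [_ sP]; rewrite tsupp_foldr; split=> [Hv a /sP[av _]|Hs].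
  by apply: hH; rewrite av.
by apply: (sH v m) => a /sP; exact: Hs.
Qed.

Definition tideal (H : set (kvertex L)) : set T := [set x | tsupp H (repr x)].

Lemma tidealE H t : hereditary H -> saturated H ->
  tideal H (tpi t) <-> tsupp H t.
Proof. by move=> hH sH; apply: tsupp_teq => //; exact: teq_repr. Qed.

Lemma tpi_addE (t u : tterm L) : (tpi t : T) + tpi u = tpi (TAdd t u).
Proof. exact: tpi_add. Qed.

Lemma tidealD H x y : hereditary H -> saturated H ->
  tideal H (x + y) <-> tideal H x /\ tideal H y.
Proof.
by move=> hH sH; rewrite -[x]tpi_repr -[y]tpi_repr tpi_addE !tidealE.
Qed.

Lemma tideal_act H q x : hereditary H -> saturated H ->
  tideal H x -> tideal H (zm_act q x).
Proof.
move=> hH sH; rewrite -[x]tpi_repr /= tpi_act !tidealE//.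
by elim: (repr x) => //= t IHt u IHu [/IHt ? /IHu].
Qed.

Lemma tideal_order_ideal H : hereditary H -> saturated H ->
  zorder_ideal (tideal H).
Proof.
move=> hH sH; split.
- exact/tidealE.
- by move=> x y Hx Hy; apply/tidealD.
- by move=> x _ [z ->] /tidealD[].
- by move=> q x; exact: tideal_act.
Qed.

Lemma tgen_tideal H v n : hereditary H -> saturated H ->
  tideal H (tgen v n) <-> H v.
Proof. by move=> hH sH; rewrite tidealE. Qed.

Lemma hvertices_tideal H : hereditary H -> saturated H ->
  hvertices (tideal H) = H.
Proof. by move=> hH sH; apply/seteqP; split=> v; rewrite /hvertices /= tgen_tideal. Qed.

Lemma tideal0 x : tideal set0 x -> x = 0.
Proof.
rewrite /tideal /= -{2}[x]tpi_repr.
elim: (repr x) => //= t IHt u IHu [/IHt t0 /IHu u0].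
by rewrite -tpi_addE t0 u0 addr0.
Qed.

Lemma tgen_sum v n m (s : seq (kpath L)) : enumerates s (paths_from v m) ->
  tgen v n = \sum_(a <- s) tgen (ksrc a) (n + degZ m).
Proof.
move=> sP; transitivity (tpi (foldr (@TAdd k L) (@TZero k L)
    [seq TGen (ksrc a) (n + degZ m) | a <- s])); first exact/tpiP/teq_rel.
elim: s {sP} => [|a s IHs] /=; first by rewrite big_nil.
by rewrite big_cons -tpi_addE IHs.
Qed.

Lemma tgen_path (a : kpath L) n : exists z,
  tgen (krng a) n = tgen (ksrc a) (n + degZ (kdeg a)) + z.
Proof.
have [s sP] := enum_paths (krng a) (kdeg a); rewrite (tgen_sum n sP).
have as_ : a \in s by apply/sP.2.
by rewrite (bigD1_seq a)//= ?sP.1//; eexists.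
Qed.

Lemma zideal_gen (J : set T) v n : zorder_ideal J -> J (tgen v n) <-> hvertices J v.
Proof.
have actE w p q : zm_act q (tgen w p : T) = tgen w (p + q) by rewrite /= tpi_act.
move=> zJ; split=> [Jv|Jv].
- by rewrite /hvertices /= -(subrr n) -actE; exact: zoi_act.
- by rewrite -[n]add0r -actE; exact: zoi_act.
Qed.

Lemma zideal_hereditary (J : set T) : zorder_ideal J -> hereditary (hvertices J).
Proof.
move=> zJ a Ja; apply/(zideal_gen _ (0 + degZ (kdeg a)) zJ).
by have [z E] := tgen_path a 0; apply: (zoi_down zJ) Ja; exists z.
Qed.

Lemma zideal_saturated (J : set T) : zorder_ideal J -> saturated (hvertices J).
Proof.
move=> zJ v m Js; have [s sP] := enum_paths v m.
rewrite /hvertices /= (tgen_sum 0 sP) big_seq.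
apply: (big_ind J); [exact: zoi_zero|exact: zoi_add|move=> a /sP.2 /Js Ja].
exact/zideal_gen.
Qed.

Lemma zideal_tideal (J : set T) : zorder_ideal J -> tideal (hvertices J) = J.
Proof.
move=> zJ; suff E t : tsupp (hvertices J) t <-> J (tpi t).
  by apply/seteqP; split=> x; rewrite /tideal /= E tpi_repr.
elim: t => [v n||t IHt u IHu] /=; first by rewrite -(zideal_gen _ n zJ).
  by split=> // _; exact: (zoi_zero zJ).
rewrite IHt IHu -tpi_addE; split=> [[Jt Ju]|Jtu]; first exact: zoi_add.
split; apply: (zoi_down zJ) Jtu; first by eexists.
by rewrite addrC; eexists.
Qed.

(** The empty set is saturated because there are no sources, and its support condition separates a
    generator from 0. *)
Lemma tgen_neq0 v n : tgen v n <> 0 :> T.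
Proof.
have h0 : hereditary set0 by [].
have s0 : saturated set0.
  by move=> w m s0; have [a /s0] := ns w m.
by move=> /(congr1 (tideal set0)) E; apply/(tgen_tideal v n h0 s0); rewrite E tidealE.
Qed.

(** An element of [tideal (vperp H)] comparable to one of [tideal H] would put the smaller of the
    two in both ideals, which meet in 0 only. *)
Lemma zperp_tideal H : hereditary H -> saturated H ->
  zperp (tideal H) = tideal (vperp H).
Proof.
move=> hH sH; have hK := @vperp_hereditary H; have sK := vperp_saturated hH.
have disj x : tideal H x -> tideal (vperp H) x -> x = 0.
  move=> Hx Kx; apply: tideal0; move: Hx Kx; rewrite /tideal /=.
  elim: (repr x) => //= [v _|t IHt u IHu [Ht Hu] [Kt Ku]].
    by move=> Hv /(vperp_disjoint Hv).
  by split; [exact: IHt|exact: IHu].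
apply/seteqP; split=> [x [xJ|->]|x Kx]; last 2 first.
- exact/tidealE.
- have [->|x0] := pselect (x = 0); [by right|left=> a Ha a0; split].
    by move=> [z E]; apply: x0; apply: disj => //; move: Ha; rewrite E => /tidealD[].
  by move=> [z E]; apply: a0; apply: disj => //; move: Kx; rewrite E => /tidealD[].
(* Only one half of incomparability is kept: no nonzero a of the ideal lies below the sum. Unlike
   membership in [zperp], this passes visibly to the summands, so induction on the term applies. *)
suff xK t : (forall a, tideal H a -> a <> 0 -> ~ alg_le a (tpi t)) ->
    tsupp (vperp H) t.
  by apply: xK => a Ha a0; rewrite tpi_repr; case: (xJ a Ha a0).
elim: t {x xJ} => //= [v n|t IHt u IHu] tJ; last first.
  split; [apply: IHt|apply: IHu] => a Ha a0 [z E]; apply: (tJ a Ha a0).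
    by exists (z + tpi u); rewrite addrA -E tpi_addE.
  by exists (z + tpi t); rewrite addrA -E addrC tpi_addE.
(* A path from v into H would put the nonzero generator at its source, an element of [tideal H],
   below [tgen v n]. *)
move=> a av Ha; have [z E] := tgen_path a n.
apply: (tJ (tgen (ksrc a) (n + degZ (kdeg a)))).
- exact/tgen_tideal.
- exact: tgen_neq0.
- by exists z; rewrite -E av.
Qed.

Lemma regZ_boolean_iso : boolean_iso RegV (RegZ T) tideal.
Proof.
apply: boolean_transport; first exact: regV_boolean.
- split.
  + move=> H rH; have hH := reg_hereditary rH; have sH := reg_saturated rH.
    split; first exact: tideal_order_ideal.
    have hK := @vperp_hereditary H.
    by rewrite (zperp_tideal hH sH) (zperp_tideal hK (vperp_saturated hH)) -rH.
  + move=> H K; rewrite !inE => rH rK /(congr1 (@hvertices k L)).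
    by rewrite !hvertices_tideal//; (exact: reg_hereditary || exact: reg_saturated).
  + move=> J [zJ rJ]; exists (hvertices J); last exact: zideal_tideal.
    have hJ := zideal_hereditary zJ; have sJ := zideal_saturated zJ.
    have hK := @vperp_hereditary (hvertices J).
    have sK := vperp_saturated hJ.
    rewrite /RegV /= {1}rJ -{1}(zideal_tideal zJ) !zperp_tideal//.
    by rewrite hvertices_tideal//; [exact: vperp_hereditary|exact: vperp_saturated].
- move=> H K rH rK.
  have hH := reg_hereditary rH; have sH := reg_saturated rH.
  have hK := reg_hereditary rK; have sK := reg_saturated rK.
  split=> [HK x|HK v Hv]; last first.
    by apply/(tgen_tideal v 0 hK sK)/HK/tgen_tideal.
  rewrite /tideal /=; elim: (repr x) => //= [v _|t IHt u IHu [/IHt ? /IHu]//].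
  exact: HK.
Qed.

End Vertices.

(** * Regular order ideals under equivariant isomorphisms *)

Section ZMonoidIso.
Variables (k : nat) (M N : zmonoid k) (f : M -> N).
Hypotheses (fbij : bijective f) (fD : forall x y, f (x + y) = f x + f y)
  (f0 : f 0 = 0) (fact : forall q x, f (zm_act q x) = zm_act q (f x)).

Lemma zmonoid_iso_le x y : alg_le (f x) (f y) <-> alg_le x y.
Proof.
have [g fK gK] := fbij.
split=> -[z E]; last by exists (f z); rewrite E fD.
by exists (g z); apply: (can_inj fK); rewrite fD gK.
Qed.

Lemma zmonoid_iso_mem (J : set M) x : (f @` J) (f x) <-> J x.
Proof. by split=> [[y Jy /(bij_inj fbij) <-]|Jx] //; exists x. Qed.

Lemma zmonoid_iso_ideal (J : set M) : zorder_ideal J -> zorder_ideal (f @` J).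
Proof.
move=> zJ; have [g fK gK] := fbij; split.
- by exists 0; [exact: zoi_zero|].
- by move=> _ _ [x Jx <-] [y Jy <-]; exists (x + y); [exact: zoi_add|].
- move=> x z xz [y Jy yE]; exists (g x) => //.
  by apply: (zoi_down zJ) Jy; apply/zmonoid_iso_le; rewrite gK yE.
- by move=> q _ [x Jx <-]; exists (zm_act q x); [exact: zoi_act|].
Qed.

Lemma zmonoid_iso_perp (J : set M) : zperp (f @` J) = f @` zperp J.
Proof.
have [g fK gK] := fbij; apply/seteqP; split=> y.
- rewrite -(gK y) => -[yJ|y0]; last first.
    by exists (g y) => //; right; apply: (can_inj fK); rewrite f0.
  exists (g y) => //; left=> a Ja a0.
  have [||ya ay] := yJ (f a); first exact/zmonoid_iso_mem.
    by rewrite -f0 => /(can_inj fK).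
  by split; rewrite -zmonoid_iso_le.
- move=> [x [xJ|->] <-]; last by right.
  left=> _ [a Ja <-] fa0; have [|xa ax] := xJ a Ja.
    by move=> a0; apply: fa0; rewrite a0.
  by split; rewrite zmonoid_iso_le.
Qed.

End ZMonoidIso.

Lemma regZ_zmonoid_iso k (M N : zmonoid k) : boolean_algebra (RegZ M) ->
  zmonoid_iso M N -> exists f, boolean_iso (RegZ M) (RegZ N) f.
Proof.
move=> MB [f [fbij f0 fD fact]]; exists (image^~ f).
have [g fK gK] := fbij.
have gbij : bijective g by exists f.
have g0 : g 0 = 0 by rewrite -f0 fK.
have gD x y : g (x + y) = g x + g y by rewrite -{1}(gK x) -{1}(gK y) -fD fK.
have gact q x : g (zm_act q x) = zm_act q (g x) by rewrite -{1}(gK x) -fact fK.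
apply: boolean_transport => //.
- split.
  + move=> J [zJ rJ]; split; first exact: zmonoid_iso_ideal.
    by rewrite !(zmonoid_iso_perp fbij)// -rJ.
  + move=> J K _ _ /seteqP[JK KJ]; apply/seteqP; split=> x.
      by move=> /(zmonoid_iso_mem fbij)/JK/(zmonoid_iso_mem fbij).
    by move=> /(zmonoid_iso_mem fbij)/KJ/(zmonoid_iso_mem fbij).
  + move=> K [zK rK]; exists (g @` K).
      by split; [exact: zmonoid_iso_ideal|rewrite !(zmonoid_iso_perp gbij)// -rK].
    by rewrite /= image_comp (_ : f \o g = id) ?image_id//; apply/funext.
- move=> J K _ _; split=> [JK|JK x]; first exact: image_subset.
  by move=> /(zmonoid_iso_mem fbij)/JK/(zmonoid_iso_mem fbij).
Qed.

(** * Infinite paths, their shifts and their prolongations *)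

Section InfinitePaths.
Variables (k : nat) (L : kgraph k).
Hypothesis ns : without_sources L.

Definition kprefix (a b : kpath L) := exists2 c, ksrc a = krng c & b = kcomp a c.

Lemma kprefix_refl a : kprefix a a.
Proof. by exists (kid (ksrc a)); rewrite ?krng_id// kcomp_idr. Qed.

Lemma kprefix_trans a b c : kprefix a b -> kprefix b c -> kprefix a c.
Proof.
move=> [x ax ->] [y]; rewrite ksrc_comp// => xy ->; exists (kcomp x y).
  by rewrite krng_comp.
by rewrite kcompA.
Qed.

Lemma kprefix_comp (c a b : kpath L) : ksrc c = krng a -> kprefix a b ->
  kprefix (kcomp c a) (kcomp c b).
Proof.
move=> ca [e ae ->]; exists e; first by rewrite ksrc_comp.
by rewrite kcompA.
Qed.

Lemma kprefix_eq a a' b : kprefix a b -> kprefix a' b -> kdeg a = kdeg a' ->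
  a = a'.
Proof. by move=> [c ac ->] [c' ac' E] /kcomp_inj/(_ E)[]. Qed.

Lemma kprefix_le a a' b n : kprefix a b -> kprefix a' b ->
  kdeg a' = kdeg a + n -> kprefix a a'.
Proof.
move=> ab a'b /factor[c [e [ca _ ce E]]].
have ca' : kprefix c a' by exists e.
by rewrite -(kprefix_eq (kprefix_trans ca' a'b) ab ca).
Qed.

Lemma kprefix_rng a b : kprefix a b -> krng b = krng a.
Proof. by move=> [c ac ->]; rewrite krng_comp. Qed.

(** The default [a] is returned only when the degree of [a] does not dominate m. *)
Definition khead (a : kpath L) m : kpath L :=
  xget a [set b | kprefix b a /\ kdeg b = m].

Lemma kheadP a m n : kdeg a = m + n -> kprefix (khead a m) a /\ kdeg (khead a m) = m.
Proof.
move=> /factor[b [c [bm _ bc E]]]; rewrite /khead.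
have ba : kprefix b a by exists c.
exact: (@xgetPex _ a [set b | kprefix b a /\ kdeg b = m] (ex_intro _ b (conj ba bm))).
Qed.

Lemma kheadE a b : kprefix b a -> khead a (kdeg b) = b.
Proof.
move=> ba; have := @xgetPex _ a [set c | kprefix c a /\ kdeg c = kdeg b]
  (ex_intro _ b (conj ba erefl)).
by move=> [ca db]; exact: kprefix_eq ca ba db.
Qed.

Definition ktail (a b : kpath L) : kpath L :=
  xget a [set c | ksrc a = krng c /\ b = kcomp a c].

Lemma ktailP a b : kprefix a b -> ksrc a = krng (ktail a b) /\ b = kcomp a (ktail a b).
Proof.
move=> [c ac bac]; exact: (@xgetPex _ a [set c | ksrc a = krng c /\ b = kcomp a c]
  (ex_intro _ c (conj ac bac))).
Qed.

Lemma ktailE a c : ksrc a = krng c -> ktail a (kcomp a c) = c.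
Proof.
move=> ac; have [ac' E] : _ /\ _ := ktailP (ex_intro2 _ _ c ac erefl).
by have [_] := kcomp_inj ac ac' erefl E.
Qed.

(* An infinite path is given by its initial segments [x(0,n)]. *)
Definition ipath := {x : 'rV[nat]_k -> kpath L |
  forall m n, kdeg (x m) = m /\ kprefix (x m) (x (m + n))}.

Definition iseg (x : ipath) n : kpath L := sval x n.

Definition irng (x : ipath) := krng (iseg x 0).

Lemma iseg_deg x n : kdeg (iseg x n) = n.
Proof. by case: (svalP x n 0). Qed.

Lemma iseg_prefix x m n : kprefix (iseg x m) (iseg x (m + n)).
Proof. by case: (svalP x m n). Qed.

Lemma iseg_rng x n : krng (iseg x n) = irng x.
Proof. by have /kprefix_rng := iseg_prefix x 0 n; rewrite add0r. Qed.

Lemma ipath_ext x y : iseg x =1 iseg y -> x = y.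
Proof. by case: x y => [x xP] [y yP] /funext; exact: eq_exist. Qed.

(** The segment of degree m of ax is cut from a x(0,m), whose degree always dominates m. This avoids
    comparing m with [kdeg a] in the partial order of degrees. *)
Lemma icons_subproof (a : kpath L) (x : ipath) : ksrc a = irng x ->
  forall m n, kdeg (khead (kcomp a (iseg x m)) m) = m /\
    kprefix (khead (kcomp a (iseg x m)) m) (khead (kcomp a (iseg x (m + n))) (m + n)).
Proof.
move=> ax m n.
have dE p : kdeg (kcomp a (iseg x p)) = p + kdeg a.
  by rewrite kdeg_comp ?iseg_rng// iseg_deg addrC.
have [p1 d1] := kheadP (dE m); have [p2 d2] := kheadP (dE (m + n)).
split=> //; apply: kprefix_le p2 _; last by rewrite d2 d1.
apply: kprefix_trans p1 _; apply: kprefix_comp; last exact: iseg_prefix.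
by rewrite iseg_rng.
Qed.

Definition icons (a : kpath L) (x : ipath) : ipath :=
  match pselect (ksrc a = irng x) with
  | left ax => exist _ _ (icons_subproof ax)
  | right _ => x
  end.

Lemma iseg_icons a x m : ksrc a = irng x ->
  iseg (icons a x) m = khead (kcomp a (iseg x m)) m.
Proof. by rewrite /icons; case: pselect. Qed.

Lemma icons_prefix a x m : ksrc a = irng x ->
  kprefix (iseg (icons a x) m) (kcomp a (iseg x m)).
Proof.
move=> ax; rewrite iseg_icons//; case: (@kheadP (kcomp a (iseg x m)) m (kdeg a)) => //.
by rewrite kdeg_comp ?iseg_rng// iseg_deg addrC.
Qed.

Lemma iseg_icons_deg a x : ksrc a = irng x -> iseg (icons a x) (kdeg a) = a.
Proof.
move=> ax; rewrite iseg_icons// kheadE//; exists (iseg x (kdeg a)) => //.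
by rewrite iseg_rng.
Qed.

Lemma irng_icons a x : ksrc a = irng x -> irng (icons a x) = krng a.
Proof. by move=> ax; rewrite -(iseg_rng _ (kdeg a)) iseg_icons_deg. Qed.

Lemma ishift_subproof (x : ipath) p m n :
  kdeg (ktail (iseg x p) (iseg x (p + m))) = m /\
  kprefix (ktail (iseg x p) (iseg x (p + m)))
          (ktail (iseg x p) (iseg x (p + (m + n)))).
Proof.
have [s1 E1] := ktailP (iseg_prefix x p m).
have [s2 E2] := ktailP (iseg_prefix x p (m + n)).
split.
  have := congr1 (@kdeg k L) E1; rewrite kdeg_comp// !iseg_deg.
  move=> /matrixP E; apply/matrixP => i j; have := E i j.
  by rewrite !mxE => /addnI.
have [e e1 E3] := iseg_prefix x (p + m) n.
have e2 : ksrc (ktail (iseg x p) (iseg x (p + m))) = krng e.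
  by rewrite -e1 {2}E1 ksrc_comp.
exists e => //.
have [|//|_ ->] := @kcomp_inj _ _ _ _ _
  (kcomp (ktail (iseg x p) (iseg x (p + m))) e) s2 _ erefl _ => //.
  by rewrite krng_comp.
by rewrite -E2 addrA E3 {1}E1 kcompA.
Qed.

Definition ishift (n : 'rV[nat]_k) (x : ipath) : ipath :=
  exist _ _ (ishift_subproof x n).

Lemma ishift_src x n : ksrc (iseg x n) = irng (ishift n x).
Proof. by have [-> _] := ktailP (iseg_prefix x n 0). Qed.

Lemma icons_ishift x n : icons (iseg x n) (ishift n x) = x.
Proof.
apply: ipath_ext => m; rewrite iseg_icons ?ishift_src//.
have [_ <-] := ktailP (iseg_prefix x n m).
by rewrite -{2}[m](iseg_deg x) kheadE// addrC; exact: iseg_prefix.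
Qed.

Lemma ishift_icons a x : ksrc a = irng x -> ishift (kdeg a) (icons a x) = x.
Proof.
move=> ax; apply: ipath_ext => m; rewrite /iseg /= -!/(iseg _ _) iseg_icons_deg//.
have axm : ksrc a = krng (iseg x m) by rewrite iseg_rng.
suff -> : iseg (icons a x) (kdeg a + m) = kcomp a (iseg x m) by rewrite ktailE.
rewrite iseg_icons// -{2}[m](iseg_deg x) -kdeg_comp// kheadE//.
by apply: kprefix_comp => //; rewrite addrC; exact: iseg_prefix.
Qed.

(** On both sides the segment of degree m is a prefix of a b x(0,m), and prefixes of equal degree
    coincide. *)
Lemma icons_comp a b x : ksrc a = krng b -> ksrc b = irng x ->
  icons (kcomp a b) x = icons a (icons b x).
Proof.
move=> ab bx; have abx : ksrc (kcomp a b) = irng x by rewrite ksrc_comp.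
have abx' : ksrc a = irng (icons b x) by rewrite irng_icons.
apply: ipath_ext => m; apply: kprefix_eq (icons_prefix m abx) _ _; last first.
  by rewrite !iseg_deg.
apply: kprefix_trans (icons_prefix m abx') _.
rewrite -kcompA//; last by rewrite iseg_rng.
by apply: kprefix_comp; [rewrite iseg_rng|exact: icons_prefix].
Qed.

Lemma irng_surj v : exists x, irng x = v.
Proof.
(* Paths of degree (1,...,1) are concatenated, since the multiples of this degree are cofinal. *)
pose one : 'rV[nat]_k := const_mx 1%N.
pose next v : kpath L := xget (kid v) (paths_from v one).
have nextP w : krng (next w) = w /\ kdeg (next w) = one.
  have [a aw] := ns w one.
  exact: (@xgetPex _ (kid w) (paths_from w one) (ex_intro _ a aw)).
pose e := fix e i := if i is i'.+1 then kcomp (e i') (next (ksrc (e i'))) else kid v.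
have eS i : ksrc (e i) = krng (next (ksrc (e i))) by case: (nextP (ksrc (e i))).
have ed i : kdeg (e i) = const_mx i.
  elim: i => [|i IHi] /=; first by rewrite kdeg_id.
  rewrite kdeg_comp// IHi; case: (nextP (ksrc (e i))) => _ ->.
  by apply/matrixP => x y; rewrite !mxE; exact: addn1.
have ep i j : kprefix (e i) (e (i + j)%N).
  elim: j => [|j IHj]; first by rewrite addn0; exact: kprefix_refl.
  by apply: kprefix_trans IHj _; rewrite addnS; exists (next (ksrc (e (i + j)%N))).
(* The sum of the coordinates bounds each of them and is additive in m; additivity makes
   [e (N (m + n))] a prolongation of [e (N m)]. *)
pose N (m : 'rV[nat]_k) := (\sum_i m ord0 i)%N.
have eN m : exists n, kdeg (e (N m)) = m + n.
  exists (\row_j (N m - m ord0 j)%N); rewrite ed; apply/matrixP => i j.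
  by rewrite !mxE ord1; apply/esym/subnKC; rewrite /N (bigD1 j)//= leq_addr.
have hP m : kprefix (khead (e (N m)) m) (e (N m)) /\ kdeg (khead (e (N m)) m) = m.
  by have [n /kheadP] := eN m.
have xP m n : kdeg (khead (e (N m)) m) = m /\
    kprefix (khead (e (N m)) m) (khead (e (N (m + n))) (m + n)).
  have [p1 d1] := hP m; have [p2 d2] := hP (m + n).
  split=> //; apply: kprefix_le p2 _; last by rewrite d1 d2.
  apply: kprefix_trans p1 _.
  have -> : N (m + n) = (N m + N n)%N.
    by rewrite /N -big_split; apply: eq_bigr => i _; rewrite mxE.
  exact: ep.
exists (exist _ _ xP); rewrite /irng /iseg /=.
have [/kprefix_rng <- _] := hP 0.
by have /kprefix_rng := ep 0%N (N 0); rewrite /= krng_id.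
Qed.

End InfinitePaths.

(** * The graded representation on functions on infinite paths *)

Section Representation.
Variables (F : fieldType) (k : nat) (L : kgraph k).
Hypothesis ns : without_sources L.

Local Notation V := (ipath L -> 'rV[int]_k -> F).

(* Paths and ghost paths act on functions on infinite paths by shifting; the
   extra integer coordinate records the degree, which makes the action graded. *)
Definition path_op (a : kpath L) (f : V) : V := fun x g =>
  if iseg x (kdeg a) == a then f (ishift (kdeg a) x) (g - degZ (kdeg a)) else 0.

Definition ghost_op (a : kpath L) (f : V) : V := fun x g =>
  if ksrc a == irng x then f (icons a x) (g + degZ (kdeg a)) else 0.

Definition vertex_op (v : kvertex L) (f : V) : V := fun x g =>
  if irng x == v then f x g else 0.

Fixpoint kop (t : kterm F L) (f : V) : V :=
  match t with
  | KVertex v => vertex_op v f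
  | KPath a => path_op (val a) f
  | KGhost a => ghost_op (val a) f
  | KZero => fun _ _ => 0
  | KOpp u => fun x g => - kop u f x g
  | KAdd u w => fun x g => kop u f x g + kop w f x g
  | KScale c u => fun x g => c * kop u f x g
  | KMul u w => kop u (kop w f)
  end.

(** Operators are bare functions, so linearity is proved by induction on terms; it validates the
    relations with a sum or a multiple in the right factor. *)
Lemma kop_linear t c f h :
  kop t (fun x g => c * f x g + h x g) = fun x g => c * kop t f x g + kop t h x g.
Proof.
elim: t c f h => [v|a|a||u IHu|u IHu w IHw|d u IHu|u IHu w IHw] c f h;
  apply/funext => x; apply/funext => g /=.
- by rewrite /vertex_op; case: ifP => _; rewrite // mulr0 addr0.
- by rewrite /path_op; case: ifP => _; rewrite // mulr0 addr0.
- by rewrite /ghost_op; case: ifP => _; rewrite // mulr0 addr0.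
- by rewrite mulr0 addr0.
- by rewrite IHu opprD mulrN.
- by rewrite IHu IHw mulrDr addrACA.
- by rewrite IHu mulrDr mulrCA.
- by rewrite IHw IHu.
Qed.

Lemma kopD t f h : kop t (fun x g => f x g + h x g) =
  fun x g => kop t f x g + kop t h x g.
Proof.
have := kop_linear t 1 f h; under [in LHS]eq_fun do under eq_fun do rewrite mul1r.
by move=> ->; apply/funext => x; apply/funext => g; rewrite mul1r.
Qed.

Lemma kop0 t : kop t (fun _ _ => 0) = fun _ _ => 0.
Proof.
(* With scalar -1 and both functions zero, the identity reads T0 = -T0 + T0. *)
have := kop_linear t (-1) (fun _ _ => 0) (fun _ _ => 0).
under [in LHS]eq_fun do under eq_fun do rewrite mulr0 addr0.
by move=> ->; apply/funext => x; apply/funext => g; rewrite mulN1r addNr.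
Qed.

Lemma kopZ t c f : kop t (fun x g => c * f x g) = fun x g => c * kop t f x g.
Proof.
have := kop_linear t c f (fun _ _ => 0).
under [in LHS]eq_fun do under eq_fun do rewrite addr0.
by move=> ->; apply/funext => x; apply/funext => g; rewrite kop0 addr0.
Qed.

Lemma degZD (m n : 'rV[nat]_k) : degZ (m + n) = degZ m + degZ n.
Proof. by apply/matrixP => i j; rewrite !mxE PoszD. Qed.

Lemma irng_iseg (x : ipath L) (a : kpath L) : iseg x (kdeg a) = a -> irng x = krng a.
Proof. by move=> xa; rewrite -(iseg_rng x (kdeg a)) xa. Qed.

Lemma path_op_comp (a b : kpath L) : ksrc a = krng b ->
  path_op a \o path_op b = path_op (kcomp a b).
Proof.
move=> ab; apply/funext => f; apply/funext => x; apply/funext => g.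
rewrite /= /path_op; case: (eqVneq _ a) => [xa|xa]; last first.
  case: eqVneq => // xab; case/eqP: xa.
  apply: (@kprefix_eq _ _ _ _ (kcomp a b)); rewrite ?iseg_deg//; last by exists b.
  by rewrite -xab kdeg_comp//; exact: iseg_prefix.
have xE : icons a (ishift (kdeg a) x) = x by rewrite -{1}xa icons_ishift.
have ax : ksrc a = irng (ishift (kdeg a) x) by rewrite -{1}xa ishift_src.
case: eqVneq => [sb|sb].
  set y := ishift (kdeg b) (ishift (kdeg a) x).
  have yE : icons b y = ishift (kdeg a) x by rewrite -{1}sb icons_ishift.
  have bs : ksrc b = irng y by rewrite -{1}sb ishift_src.
  have xE' : icons (kcomp a b) y = x by rewrite icons_comp// yE.
  have aby : ksrc (kcomp a b) = irng y by rewrite ksrc_comp.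
  rewrite -{1}xE' iseg_icons_deg// eqxx -[in RHS]xE' ishift_icons//.
  by rewrite kdeg_comp// degZD opprD addrA.
case: eqVneq => // xab; case/eqP: sb.
set y := ishift (kdeg (kcomp a b)) x.
have aby : ksrc (kcomp a b) = irng y by rewrite -{1}xab ishift_src.
have xE' : icons (kcomp a b) y = x by rewrite -{1}xab icons_ishift.
have bs : ksrc b = irng y by rewrite -aby ksrc_comp.
rewrite -xE' icons_comp// ishift_icons; first exact: iseg_icons_deg.
by rewrite irng_icons.
Qed.

Lemma ghost_op_comp (a b : kpath L) : ksrc a = krng b ->
  ghost_op b \o ghost_op a = ghost_op (kcomp a b).
Proof.
move=> ab; apply/funext => f; apply/funext => x; apply/funext => g.
rewrite /= /ghost_op ksrc_comp//; case: eqVneq => // bx.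
by rewrite irng_icons// ab eqxx icons_comp// kdeg_comp// degZD [degZ _ + _]addrC addrA.
Qed.

Lemma ghost_path_op (a b : kpath L) : kdeg a = kdeg b ->
  ghost_op a \o path_op b = if a == b then vertex_op (ksrc a) else fun _ _ _ => 0.
Proof.
move=> ab; apply/funext => f; apply/funext => x; apply/funext => g.
rewrite /= /ghost_op /path_op; case: (eqVneq (ksrc a)) => [ax|ax]; last first.
  by case: (a == b) => //; rewrite /vertex_op eq_sym (negPf ax).
rewrite -ab iseg_icons_deg//; case: (a == b) => //.
by rewrite /vertex_op -ax eqxx ishift_icons// addrK.
Qed.

(** Thus s_a s_a^* acts as multiplication by the indicator of the infinite paths beginning with
    a. *)
Lemma path_ghost_op (a : kpath L) f x g :
  path_op a (ghost_op a f) x g = if iseg x (kdeg a) == a then f x g else 0.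
Proof.
rewrite /path_op /ghost_op; case: eqVneq => // xa.
have ax : ksrc a = irng (ishift (kdeg a) x) by rewrite -{1}xa ishift_src.
by rewrite ax eqxx -{1}xa icons_ishift subrK.
Qed.

Lemma kop_keq t u : keq t u -> kop t = kop u.
Proof.
elim=> {t u} //=.
- by move=> t u w _ -> _ ->.
- by move=> t u _ ->.
- by move=> t t' u u' _ -> _ ->.
- by move=> c t u _ ->.
- by move=> t t' u u' _ -> _ ->.
- by move=> x y z; do 3!apply/funext => ?; rewrite addrA.
- by move=> x y; do 3!apply/funext => ?; rewrite addrC.
- by move=> x; do 3!apply/funext => ?; rewrite add0r.
- by move=> x; do 3!apply/funext => ?; rewrite addNr.
- by move=> c d x; do 3!apply/funext => ?; rewrite mulrA.
- by move=> x; do 3!apply/funext => ?; rewrite mul1r.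
- by move=> c x y; do 3!apply/funext => ?; rewrite mulrDr.
- by move=> c d x; do 3!apply/funext => ?; rewrite mulrDl.
- by move=> x y z; apply/funext => f; rewrite kopD.
- by move=> c x y; apply/funext => f; rewrite kopZ.
- by move=> v; do 3!apply/funext => ?; rewrite /vertex_op; case: eqVneq.
- move=> u v uv; apply/funext => f; apply/funext => x; apply/funext => g.
  by rewrite /vertex_op; case: eqVneq => // ->; case: eqVneq.
- by move=> a b c ab ->; exact: path_op_comp.
- by move=> a b c ab ->; exact: ghost_op_comp.
- move=> a; apply/funext => f; apply/funext => x; apply/funext => g.
  rewrite /vertex_op /path_op; case: (eqVneq (iseg _ _)) => [/irng_iseg ->|].
    by rewrite eqxx.
  by rewrite if_same.
- move=> a; apply/funext => f; apply/funext => x; apply/funext => g.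
  rewrite /vertex_op /path_op; case: (eqVneq (iseg _ _)) => // xa.
  by rewrite -ishift_src xa eqxx.
- move=> a; apply/funext => f; apply/funext => x; apply/funext => g.
  by rewrite /vertex_op /ghost_op eq_sym; case: eqVneq.
- move=> a; apply/funext => f; apply/funext => x; apply/funext => g.
  rewrite /vertex_op /ghost_op; case: eqVneq => // ax.
  by rewrite irng_icons// eqxx.
- by move=> a; rewrite -[LHS]/(ghost_op _ \o path_op _) ghost_path_op// eqxx.
- move=> a b ab aNb; rewrite -[LHS]/(ghost_op _ \o path_op _) ghost_path_op//.
  by case: eqP => // /val_inj.
- move=> v n s _ [us sP]; apply/funext => f; apply/funext => x; apply/funext => g.
  (* An infinite path with range v has exactly one initial segment in the enumerated set, so one
     summand survives; with another range none does. *)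
  transitivity (\sum_(a <- [seq val a | a <- s]) if iseg x (kdeg a) == a then f x g else 0).
    rewrite /vertex_op; case: eqVneq => [xv|xv].
      have xs : iseg x n \in [seq val a | a <- s].
        by apply/sP; split; rewrite ?iseg_rng ?iseg_deg.
      rewrite (bigD1_seq _ xs us)/= iseg_deg eqxx big_seq_cond big1 ?addr0//.
      move=> a /andP[/sP[_ ->]]; rewrite eq_sym; by case: eqP.
    rewrite big_seq big1// => a /sP[av _]; case: eqVneq => // /irng_iseg xa.
    by case/eqP: xv; rewrite xa.
  rewrite big_map {us sP}; elim: s => [|a s IHs] /=; first by rewrite big_nil.
  by rewrite big_cons IHs -path_ghost_op.
Qed.

Local Notation K := (KP F L).

Definition kact (x : K) : V -> V := kop (repr (x : kpq F L)).

Lemma kact_pi t : kact (kpi t) = kop t.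
Proof. by apply: kop_keq; exact: keq_repr. Qed.

Lemma kactD (x y : K) f p g : kact (x + y) f p g = kact x f p g + kact y f p g.
Proof.
rewrite -[x in LHS](kpi_repr (x : kpq F L)) -[y in LHS](kpi_repr (y : kpq F L)).
by rewrite (kpi_addE (repr (x : kpq F L)) (repr (y : kpq F L))) kact_pi.
Qed.

Lemma kactZ c (x : K) f p g : kact (c *: x) f p g = c * kact x f p g.
Proof.
rewrite -[x in LHS](kpi_repr (x : kpq F L)).
by rewrite (kpi_scaleE c (repr (x : kpq F L))) kact_pi.
Qed.

Lemma kactM (x y : K) f : kact (nu_mul x y) f = kact x (kact y f).
Proof. by rewrite /nu_mul /= /kpq_mul kact_pi. Qed.

Lemma kact0 f p g : kact 0 f p g = 0.
Proof. by rewrite -(scale0r (0 : K)) kactZ mul0r. Qed.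

(** Homogeneity is only generated inductively; here the degree becomes observable, as a translation
    of the slices of the integer coordinate. *)
Lemma kact_homog n (x : K) : kp_homog n x -> forall (f : V) h,
  (forall p g, g != h -> f p g = 0) ->
  forall p g, g != h + n -> kact x f p g = 0.
Proof.
elim=> {n x}.
- move=> v f h fh p g; rewrite addr0 kact_pi /= /vertex_op => /fh ->.
  by rewrite if_same.
- move=> a f h fh p g gh; rewrite kact_pi /= /path_op fh ?if_same//.
  by rewrite subr_eq.
- move=> a f h fh p g gh; rewrite kact_pi /= /ghost_op fh ?if_same//.
  by rewrite -subr_eq opprK in gh.
- by move=> n f h _ p g _; rewrite kact0.
- by move=> n x y _ IHx _ IHy f h fh p g gh; rewrite kactD (IHx f h)// (IHy f h)// addr0.
- by move=> n c x _ IHx f h fh p g gh; rewrite kactZ (IHx f h)// mulr0.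
- move=> m n x y _ IHx _ IHy f h fh p g gh; rewrite kactM.
  apply: (IHx _ (h + n)); first by move=> q e; exact: IHy.
  by rewrite -addrA [n + m]addrC.
Qed.

(* The functional is a diagonal matrix coefficient of the representation. *)
Lemma vertex_functional (v : kvertex L) : exists phi : K -> F,
  [/\ forall x y, phi (x + y) = phi x + phi y, forall c x, phi (c *: x) = c * phi x,
      phi (kp_vertex F v) = 1 & forall n x, n != 0 -> kp_homog n x -> phi x = 0].
Proof.
have [p pv] := irng_surj ns v.
(* The indicator of slice 0: [kp_vertex F v] fixes its value at (p, 0), while a nonzero degree moves
   the support off slice 0. *)
pose f : V := fun q g => if g == 0 then 1 else 0.
exists (fun x => kact x f p 0); split=> [x y|c x||n x n0 xn].
- exact: kactD.
- exact: kactZ.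
- by rewrite kact_pi /= /vertex_op pv eqxx /f eqxx.
- apply: (kact_homog xn (h := 0)); last by rewrite add0r eq_sym.
  by move=> q g /negPf g0; rewrite /f g0.
Qed.

End Representation.

Local Arguments nu_mul : simpl never.

(** * Ideals and annihilators in algebras without unit *)

Section NUAlgTheory.
Variables (F : fieldType) (A : nualg F).
Local Notation "x ** y" := (@nu_mul F A x y) (at level 40, left associativity).

Lemma nu_mul0r (x : A) : 0 ** x = 0.
Proof. by have := nu_scaleAl 0 (0 : A) x; rewrite !scale0r. Qed.

Lemma nu_mulr0 (x : A) : x ** 0 = 0.
Proof. by have := nu_scaleAr 0 x (0 : A); rewrite !scale0r. Qed.

Lemma nu_mul_suml I (s : seq I) (P : pred I) (f : I -> A) x :
  (\sum_(i <- s | P i) f i) ** x = \sum_(i <- s | P i) f i ** x.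
Proof.
by apply: (big_morph (fun y => y ** x)) => [y z|]; rewrite ?nu_mulDl ?nu_mul0r.
Qed.

Lemma nu_mul_sumr I (s : seq I) (P : pred I) (f : I -> A) x :
  x ** (\sum_(i <- s | P i) f i) = \sum_(i <- s | P i) x ** f i.
Proof.
by apply: (big_morph (fun y => x ** y)) => [y z|]; rewrite ?nu_mulDr ?nu_mulr0.
Qed.

Lemma ideal_gen_ideal (S : set A) : nuideal (ideal_gen S).
Proof.
split=> [I hI _|x y Ix Iy I hI SI|c x Ix I hI SI|a x Ix I hI SI|a x Ix I hI SI].
- exact: nui_zero.
- by apply: nui_add => //; [exact: Ix|exact: Iy].
- by apply: nui_scale => //; exact: Ix.
- by apply: nui_mull => //; exact: Ix.
- by apply: nui_mulr => //; exact: Ix.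
Qed.

Lemma annihilator_ideal (I : set A) : nuideal I -> nuideal (annihilator I).
Proof.
move=> hI; split=> [a _|x y Jx Jy a Ia|c x Jx a Ia|b x Jx a Ia|b x Jx a Ia].
- by rewrite nu_mul0r nu_mulr0.
- have [xa ax] := Jx a Ia; have [ya ay] := Jy a Ia.
  by rewrite nu_mulDl nu_mulDr xa ax ya ay addr0.
- have [xa ax] := Jx a Ia.
  by rewrite -nu_scaleAl -nu_scaleAr xa ax scaler0.
- have [xa _] := Jx a Ia; have [_ abx] := Jx (a ** b) (nui_mulr hI b Ia).
  by rewrite nu_mulA abx -nu_mulA xa nu_mulr0.
- have [xba _] := Jx (b ** a) (nui_mull hI b Ia); have [_ ax] := Jx a Ia.
  by rewrite -nu_mulA xba nu_mulA ax nu_mul0r.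
Qed.

Lemma annihilatorS (I J : set A) : I `<=` J -> annihilator J `<=` annihilator I.
Proof. by move=> IJ x Jx a /IJ; exact: Jx. Qed.

Lemma nuideal0 : nuideal ([set 0] : set A).
Proof.
split=> //= [x y -> ->|c x ->|a x ->|a x ->].
- exact: addr0.
- exact: scaler0.
- exact: nu_mulr0.
- exact: nu_mul0r.
Qed.

End NUAlgTheory.

(** * Relations of the Kumjian-Pask algebra for paths of every degree *)

Section KumjianPaskTheory.
Variables (F : fieldType) (k : nat) (L : kgraph k).
Hypotheses (rf : row_finite L) (ns : without_sources L).

Local Notation K := (KP F L).
Local Notation "x ** y" := (@nu_mul F K x y) (at level 40, left associativity).
Local Notation pv := (@kp_vertex F k L).

(* The generators [s_a] and [s_a^*], extended by [s_v = s_v^* = p_v] to the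
   paths of degree 0. *)
Definition spath (a : kpath L) : K :=
  if insub a is Some b then kp_path F b else pv (krng a).
Definition sghost (a : kpath L) : K :=
  if insub a is Some b then kp_ghost F b else pv (krng a).

Lemma kdeg_eq0 (a : kpath L) : kdeg a = 0 -> a = kid (krng a).
Proof.
move=> a0; have a0' : kdeg a = 0 + 0 by rewrite addr0.
by have [] := @kcomp_inj _ _ (kid (krng a)) a a (kid (ksrc a));
   rewrite ?ksrc_id ?krng_id ?kdeg_id ?kcomp_idl ?kcomp_idr.
Qed.

(** Replaces a path together with both of its generators, so that each relation splits into a vertex
    case and a case of the presentation. *)
Variant path_spec (a : kpath L) : kpath L -> K -> K -> Type :=
  | PathVertex v : path_spec a (kid v) (pv v) (pv v)
  | PathPos (b : kppath L) : path_spec a (val b) (kp_path F b) (kp_ghost F b).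

Lemma pathP a : path_spec a a (spath a) (sghost a).
Proof.
rewrite /spath /sghost; case: insubP => [b _ <-|]; first exact: PathPos.
rewrite negbK => /eqP/kdeg_eq0; move: (krng a) => v ->; exact: PathVertex.
Qed.

Lemma spath_val (b : kppath L) : spath (val b) = kp_path F b.
Proof. by rewrite /spath valK. Qed.

Lemma sghost_val (b : kppath L) : sghost (val b) = kp_ghost F b.
Proof. by rewrite /sghost valK. Qed.

Lemma spath_id v : spath (kid v) = pv v.
Proof. by rewrite /spath insubF ?krng_id// kdeg_id eqxx. Qed.

Lemma sghost_id v : sghost (kid v) = pv v.
Proof. by rewrite /sghost insubF ?krng_id// kdeg_id eqxx. Qed.

Lemma kpi_mulE t u : (kpi t : K) ** kpi u = kpi (KMul t u).
Proof. exact: kpi_mul. Qed.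

Lemma vertex_idem v : pv v ** pv v = pv v.
Proof. by rewrite kpi_mulE; exact/kpiP/keq_pp. Qed.

Lemma vertex_orth u v : u <> v -> pv u ** pv v = 0.
Proof. by move=> uv; rewrite kpi_mulE; exact/kpiP/keq_pp0. Qed.

Lemma vertex_spath a : pv (krng a) ** spath a = spath a.
Proof.
case: pathP => [v|b]; first by rewrite krng_id vertex_idem.
by rewrite kpi_mulE; exact/kpiP/keq_ps.
Qed.

Lemma spath_vertex a : spath a ** pv (ksrc a) = spath a.
Proof.
case: pathP => [v|b]; first by rewrite ksrc_id vertex_idem.
by rewrite kpi_mulE; exact/kpiP/keq_sp.
Qed.

Lemma vertex_sghost a : pv (ksrc a) ** sghost a = sghost a.
Proof.
case: pathP => [v|b]; first by rewrite ksrc_id vertex_idem.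
by rewrite kpi_mulE; exact/kpiP/keq_pg.
Qed.

Lemma sghost_vertex a : sghost a ** pv (krng a) = sghost a.
Proof.
case: pathP => [v|b]; first by rewrite krng_id vertex_idem.
by rewrite kpi_mulE; exact/kpiP/keq_gp.
Qed.

Definition kpos (a : kpath L) (a0 : kdeg a != 0) : kppath L :=
  exist (fun b => is_true (kdeg b != 0)) a a0.

Lemma kcomp_pos (a b : kppath L) : ksrc (val a) = krng (val b) ->
  exists c : kppath L, val c = kcomp (val a) (val b).
Proof.
move=> ab; suff ab0 : kdeg (kcomp (val a) (val b)) != 0 by exists (kpos ab0).
rewrite kdeg_comp//; apply: contra (valP a) => /eqP/matrixP E.
apply/eqP/matrixP => i j; move: (E i j); rewrite !mxE => /eqP.
by rewrite addn_eq0 => /andP[/eqP].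
Qed.

Lemma spath_comp a b : ksrc a = krng b -> spath a ** spath b = spath (kcomp a b).
Proof.
case: (pathP a) => [v|a']; first by rewrite ksrc_id => ->; rewrite kcomp_idl vertex_spath.
case: (pathP b) => [v|b'] ab.
  by move: ab; rewrite krng_id => <-; rewrite kcomp_idr -spath_val spath_vertex.
have [c E] := kcomp_pos ab.
by rewrite -E spath_val kpi_mulE; exact/kpiP/keq_ss.
Qed.

Lemma sghost_comp a b : ksrc a = krng b -> sghost b ** sghost a = sghost (kcomp a b).
Proof.
case: (pathP a) => [v|a']; first by rewrite ksrc_id => ->; rewrite kcomp_idl sghost_vertex.
case: (pathP b) => [v|b'] ab.
  by move: ab; rewrite krng_id => <-; rewrite kcomp_idr -sghost_val vertex_sghost.
have [c E] := kcomp_pos ab.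
by rewrite -E sghost_val kpi_mulE; exact/kpiP/keq_gg.
Qed.

Lemma sghost_spath a b : kdeg a = kdeg b ->
  sghost a ** spath b = if a == b then pv (ksrc a) else 0.
Proof.
case: (pathP a) => [v|a']; case: (pathP b) => [w|b'].
- move=> _; case: eqP => [/(congr1 (@ksrc k L))|vw].
    by rewrite !ksrc_id => ->; exact: vertex_idem.
  by apply: vertex_orth => vw'; apply: vw; rewrite vw'.
- by rewrite kdeg_id => /eqP; rewrite eq_sym (negPf (valP b')).
- by rewrite kdeg_id => /eqP; rewrite (negPf (valP a')).
- move=> ab; rewrite kpi_mulE (inj_eq val_inj).
  case: eqP => [<-|nab]; apply/kpiP; first exact: keq_gs.
  exact: keq_gs0.
Qed.

(** In degree 0 the only path at v is the identity and the formula is idempotency; in other degrees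
    it is the relation of the presentation. *)
Lemma vertex_sum v n (s : seq (kpath L)) : enumerates s (paths_from v n) ->
  pv v = \sum_(a <- s) spath a ** sghost a.
Proof.
move=> [us sP]; have [n0|/eqP n0] := eqVneq n 0.
  have vs : kid v \in s by apply/sP; split; rewrite ?krng_id ?kdeg_id.
  rewrite (bigD1_seq _ vs us)/= big_seq_cond big1 ?addr0.
    by rewrite spath_id sghost_id vertex_idem.
  move=> a /andP[/sP[<- an]]; rewrite n0 in an.
  by move/eqP; case; exact: kdeg_eq0.
have [s' sE] : exists s' : seq (kppath L), s = [seq val a | a <- s'].
  have : forall a, a \in s -> kdeg a != 0 by move=> a /sP[_ ->]; apply/eqP.
  elim: s {us sP} => [|a s IHs] sn0; first by exists [::].
  have [|s' ->] := IHs; first by move=> b bs; apply: sn0; rewrite inE bs orbT.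
  have a0 : kdeg a != 0 by apply: sn0; rewrite inE eqxx.
  by exists (kpos a0 :: s').
rewrite sE big_map; transitivity (kpi (foldr (@KAdd F k L) (@KZero F k L)
    [seq KMul (KPath F a) (KGhost F a) | a <- s']) : K).
  by apply/kpiP/(keq_sum _ n0); rewrite -sE.
elim: s' {sE} => [|a s' IHs] /=; first by rewrite big_nil.
by rewrite big_cons spath_val sghost_val -kpi_addE IHs kpi_mulE.
Qed.

Lemma spath_homog a : kp_homog (degZ (kdeg a)) (spath a).
Proof.
case: pathP => [v|b]; last exact: kph_path.
by rewrite kdeg_id (_ : degZ 0 = 0); [exact: kph_vertex|apply/matrixP => i j; rewrite !mxE].
Qed.

Lemma sghost_homog a : kp_homog (- degZ (kdeg a)) (sghost a).
Proof.
case: pathP => [v|b]; last exact: kph_ghost.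
by rewrite kdeg_id (_ : - degZ 0 = 0); [exact: kph_vertex|apply/matrixP => i j; rewrite !mxE].
Qed.

Lemma spath_orth a b : ksrc a <> krng b -> spath a ** spath b = 0.
Proof.
move=> ab; rewrite -(spath_vertex a) -(vertex_spath b) nu_mulA -[_ ** _ ** pv _]nu_mulA.
by rewrite vertex_orth// nu_mulr0 nu_mul0r.
Qed.

Lemma sghost_orth a b : ksrc a <> krng b -> sghost b ** sghost a = 0.
Proof.
move=> ab; rewrite -(vertex_sghost a) -(sghost_vertex b) nu_mulA -[_ ** _ ** pv _]nu_mulA.
by rewrite vertex_orth ?nu_mulr0 ?nu_mul0r//; exact/nesym.
Qed.

Lemma vertex_spath_orth v a : v <> krng a -> pv v ** spath a = 0.
Proof. by move=> va; rewrite -(vertex_spath a) nu_mulA vertex_orth// nu_mul0r. Qed.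

Lemma sghost_vertex_orth v a : krng a <> v -> sghost a ** pv v = 0.
Proof. by move=> va; rewrite -(sghost_vertex a) -nu_mulA vertex_orth// nu_mulr0. Qed.

(** * Local units and expansions at a fixed degree *)

Definition vunit (s : seq (kvertex L)) : K := \sum_(v <- s) pv v.

Lemma vunit_vertex s v : uniq s -> v \in s ->
  vunit s ** pv v = pv v /\ pv v ** vunit s = pv v.
Proof.
move=> us vs; rewrite /vunit nu_mul_suml nu_mul_sumr !(bigD1_seq _ vs us)/=.
by rewrite vertex_idem !big1 ?addr0// => u /eqP uv; rewrite vertex_orth//; exact/nesym.
Qed.

Lemma local_unit (x : K) : exists2 s, uniq s & vunit s ** x = x /\ x ** vunit s = x.
Proof.
(* Asking for all larger duplicate-free lists makes the property survive concatenation of lists, as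
   sums and products require. *)
pose has_unit (y : K) := exists s : seq (kvertex L), forall s' : seq (kvertex L),
  uniq s' -> {subset s <= s'} -> vunit s' ** y = y /\ y ** vunit s' = y.
suff [s sP] : has_unit x.
  exists (undup s); first exact: undup_uniq.
  by apply: sP; [exact: undup_uniq|move=> v; rewrite mem_undup].
have gen u w (y : K) : pv u ** y = y -> y ** pv w = y -> has_unit y.
  move=> uy yw; exists [:: u; w] => s us ss.
  have [e1 _] : _ /\ _ := vunit_vertex us (ss u (mem_head _ _)).
  have [_ e2] : _ /\ _ := vunit_vertex us (ss w (mem_last u [:: w])).
  by rewrite -{1}uy -{3}yw nu_mulA e1 -nu_mulA e2.
rewrite -(kpi_repr (x : kpq F L)); elim: (repr (x : kpq F L)) => {x}.
- by move=> v; apply: (gen v v (pv v)); exact: vertex_idem.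
- move=> a; apply: (gen (krng (val a)) (ksrc (val a)) (kp_path F a)); rewrite -spath_val.
    exact: vertex_spath.
  exact: spath_vertex.
- move=> a; apply: (gen (ksrc (val a)) (krng (val a)) (kp_ghost F a)); rewrite -sghost_val.
    exact: vertex_sghost.
  exact: sghost_vertex.
- by exists [::] => s _ _; rewrite -[kpi _]/(0 : K) nu_mulr0 nu_mul0r.
- move=> t [s sP]; exists s => s' us ss; have [e1 e2] := sP s' us ss.
  rewrite (_ : kpi _ = - 1 *: (kpi t : K)).
    by rewrite -nu_scaleAr e1 -nu_scaleAl e2.
  by rewrite scaleN1r; apply/esym; exact: kpi_opp.
- move=> t [s1 s1P] u [s2 s2P]; exists (s1 ++ s2) => s us ss.
  have [|e1 e2] := s1P s us; first by move=> v vs; apply: ss; rewrite mem_cat vs.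
  have [|e3 e4] := s2P s us; first by move=> v vs; apply: ss; rewrite mem_cat vs orbT.
  by rewrite -kpi_addE nu_mulDl nu_mulDr e1 e2 e3 e4.
- move=> c t [s sP]; exists s => s' us ss; have [e1 e2] := sP s' us ss.
  by rewrite -kpi_scaleE -nu_scaleAr e1 -nu_scaleAl e2.
- move=> t [s1 s1P] u [s2 s2P]; exists (s1 ++ s2) => s us ss.
  have [|e1 e2] := s1P s us; first by move=> v vs; apply: ss; rewrite mem_cat vs.
  have [|e3 e4] := s2P s us; first by move=> v vs; apply: ss; rewrite mem_cat vs orbT.
  by rewrite -kpi_mulE nu_mulA e1 -nu_mulA e4.
Qed.

(** Inserting this resolution next to an element cuts it at any prescribed degree. *)
Lemma vunit_paths s n : exists2 E, (forall a, a \in E -> kdeg a = n) &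
  vunit s = \sum_(a <- E) spath a ** sghost a.
Proof.
elim: s => [|v s [E En sE]]; first by exists [::]; rewrite // /vunit !big_nil.
have [Ev EvP] := enum_paths rf v n.
exists (Ev ++ E); last by rewrite big_cat /vunit big_cons -(vertex_sum EvP) -sE.
by move=> a; rewrite mem_cat => /orP[/EvP.2[]|/En].
Qed.

Lemma expandl x n : exists2 E, (forall a, a \in E -> kdeg a = n) &
  x = \sum_(a <- E) spath a ** (sghost a ** x).
Proof.
have [s _ [sx _]] := local_unit x; have [E En sE] := vunit_paths s n; exists E => //.
by rewrite -{1}sx sE nu_mul_suml; apply: eq_bigr => a _; rewrite nu_mulA.
Qed.

Lemma expandr x n : exists2 E, (forall a, a \in E -> kdeg a = n) &
  x = \sum_(a <- E) (x ** spath a) ** sghost a.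
Proof.
have [s _ [_ xs]] := local_unit x; have [E En sE] := vunit_paths s n; exists E => //.
by rewrite -{1}xs sE nu_mul_sumr; apply: eq_bigr => a _; rewrite nu_mulA.
Qed.

(** * Homogeneous elements cut down to scalars *)

Lemma degZ_pos_neg (n : 'rV[int]_k) : exists p q, degZ p - degZ q = n.
Proof.
exists (map_mx (fun z => if z is Posz m then m else 0%N) n),
  (map_mx (fun z => if z is Negz m then m.+1 else 0%N) n).
by apply/matrixP => i j; rewrite !mxE; case: (n i j) => m; rewrite ?subr0 ?sub0r ?NegzE.
Qed.

(* A homogeneous [x] becomes scalar once both sides are cut at large enough
   degrees: it is a combination of [s_a s_b^*] with all [a] of degree [p] and all
   [b] of degree [q]. *)
Lemma homog_scalar n x : kp_homog n x -> exists p q, degZ p - degZ q = n /\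
  forall m a b, kdeg a = p + m -> kdeg b = q + m ->
    exists c, sghost a ** x ** spath b = c *: pv (ksrc a).
Proof.
have coef (b : bool) v : exists c, (if b then pv v else 0) = c *: pv v.
  by case: b; [exists 1; rewrite scale1r|exists 0; rewrite scale0r].
elim=> {n x}.
- move=> v; exists 0, 0; rewrite subrr; split=> // m a b am bm.
  have [vb|vb] := eqVneq v (krng b); last first.
    by exists 0; rewrite scale0r -nu_mulA vertex_spath_orth ?nu_mulr0//; exact/eqP.
  by rewrite -nu_mulA vb vertex_spath sghost_spath ?am ?bm//; exact: coef.
- move=> l; exists (kdeg (val l)), 0; split.
    by rewrite (_ : degZ 0 = 0) ?subr0//; apply/matrixP => i j; rewrite !mxE.
  move=> m a b am bm; rewrite -nu_mulA -spath_val.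
  have [lb|lb] := eqVneq (ksrc (val l)) (krng b); last first.
    by exists 0; rewrite scale0r spath_orth ?nu_mulr0//; exact/eqP.
  rewrite spath_comp// sghost_spath; first exact: coef.
  by rewrite kdeg_comp// am bm add0r.
- move=> l; exists 0, (kdeg (val l)); split.
    by rewrite (_ : degZ 0 = 0) ?sub0r//; apply/matrixP => i j; rewrite !mxE.
  move=> m a b am bm; rewrite -sghost_val.
  have [la|la] := eqVneq (ksrc (val l)) (krng a); last first.
    by exists 0; rewrite scale0r sghost_orth ?nu_mul0r//; exact/eqP.
  rewrite sghost_comp// sghost_spath; last by rewrite kdeg_comp// am bm add0r.
  by rewrite ksrc_comp//; exact: coef.
- move=> n; have [p [q pq]] := degZ_pos_neg n; exists p, q; split=> // m a b _ _.
  by exists 0; rewrite nu_mulr0 nu_mul0r scale0r.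
- move=> n x y _ [p1 [q1 [pq1 IHx]]] _ [p2 [q2 [pq2 IHy]]].
  (* A pair above both given ones: the differences agree, hence q1 + p2 = q2 + p1. *)
  exists (p1 + p2), (q1 + p2); rewrite !degZD; split.
    by rewrite opprD addrACA subrr addr0.
  have qp : q1 + p2 = q2 + p1.
    have : degZ (q1 + p2) = degZ (q2 + p1).
      have /eqP : degZ p1 - degZ q1 = degZ p2 - degZ q2 by rewrite pq1.
      rewrite subr_eq addrAC eq_sym subr_eq !degZD.
      by rewrite ![degZ _ + degZ p2]addrC [_ + degZ p1]addrC => /eqP.
    by move=> /matrixP E; apply/matrixP => i j; have := E i j; rewrite !mxE => -[].
  move=> m a b am bm.
  have [||c1 E1] := IHx (p2 + m) a b; rewrite ?addrA//.
  have [||c2 E2] := IHy (p1 + m) a b.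
  - by rewrite am addrA [p2 + p1]addrC.
  - by rewrite bm qp addrA.
  by exists (c1 + c2); rewrite nu_mulDr nu_mulDl E1 E2 scalerDl.
- move=> n c x _ [p [q [pq IHx]]]; exists p, q; split=> // m a b am bm.
  have [d E] := IHx m a b am bm; exists (c * d).
  by rewrite -nu_scaleAr -nu_scaleAl E scalerA.
- move=> n1 n2 x y _ [p1 [q1 [pq1 IHx]]] _ [p2 [q2 [pq2 IHy]]].
  exists (p1 + p2), (q1 + q2); split.
    by rewrite !degZD opprD addrACA pq1 pq2.
  move=> m a b am bm.
  (* The middle degree suits both factors: it is q1 + (p2 + m) as a right cut of x and p2 + (q1 + m)
     as a left cut of y. *)
  have [E En xE] := expandr x (q1 + p2 + m).
  rewrite [x in x ** y]xE nu_mul_suml nu_mul_sumr nu_mul_suml.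
  have step e : e \in E -> exists c, sghost a ** (x ** spath e ** sghost e ** y) ** spath b
      = c *: pv (ksrc a).
    move=> /En eE.
    have [||c1 E1] := IHx (p2 + m) a e; rewrite ?addrA//.
    have [||c2 E2] := IHy (q1 + m) e b.
    - by rewrite eE addrA [p2 + q1]addrC.
    - by rewrite bm addrA [q2 + q1]addrC.
    exists (if ksrc a == ksrc e then c1 * c2 else 0).
    rewrite (_ : _ ** spath b = (sghost a ** x ** spath e) ** (sghost e ** y ** spath b)).
      rewrite E1 E2 -nu_scaleAr -nu_scaleAl !scalerA.
      have [<-|/eqP ae] := eqVneq (ksrc a); first by rewrite vertex_idem mulrC.
      by rewrite vertex_orth// scaler0 scale0r.
    by rewrite !nu_mulA.
  elim: (E) step => [|e E' IHE] step; first by exists 0; rewrite big_nil scale0r.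
  have [|c1 E1] := step e; first exact: mem_head.
  have [|c2 E2] := IHE; first by move=> f fE; apply: step; rewrite inE fE orbT.
  by exists (c1 + c2); rewrite big_cons E1 E2 scalerDl.
Qed.

(** Expanding on both sides writes x as a sum of terms s_a (s_a^* x s_b) s_b^* whose middle factors
    are scalar. With J the zero ideal this becomes a test for x = 0. *)
Lemma homog_in_ideal n x (J : set K) : nuideal J -> kp_homog n x ->
  (forall a b c, degZ (kdeg a) - degZ (kdeg b) = n ->
     sghost a ** x ** spath b = c *: pv (ksrc a) -> J (c *: pv (ksrc a))) ->
  J x.
Proof.
move=> hJ /homog_scalar[p [q [pq xpq]]] Jx.
have [E1 E1p ->] := expandl x p; rewrite big_seq.
apply: (big_ind J) => [||a /E1p ap]; [exact: nui_zero|exact: nui_add|].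
apply: nui_mull => //; have [E2 E2q ->] := expandr (sghost a ** x) q; rewrite big_seq.
apply: (big_ind J) => [||b /E2q bq]; [exact: nui_zero|exact: nui_add|].
apply: nui_mulr => //; have [||c E] := xpq 0 a b; rewrite ?addr0//.
by rewrite E; apply: Jx E; rewrite ap bq.
Qed.

(** * Independence of the homogeneous components *)

Lemma vertex_neq0 v : pv v <> 0.
Proof.
have [phi [_ phiZ phi1 _]] := vertex_functional F ns v.
move=> v0; have : (1 : F) = 0 by rewrite -phi1 v0 -(scale0r (0 : K)) phiZ mul0r.
by apply/eqP; exact: oner_neq0.
Qed.

(** Cutting the sum by s_a^* and s_b turns the term of index i into c times a vertex and gives every
    other term a nonzero degree; the functional at that vertex then reads off c = 0. The injective
    degree map [d] admits families of shifted degrees, as needed for annihilators. *)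
Lemma homog_independent (I : eqType) (s : seq I) (d : I -> 'rV[int]_k) (y : I -> K) :
  uniq s -> injective d -> (forall i, i \in s -> kp_homog (d i) (y i)) ->
  \sum_(i <- s) y i = 0 -> forall i, i \in s -> y i = 0.
Proof.
move=> us dinj yh y0 i si.
apply: (homog_in_ideal (@nuideal0 F K) (yh i si)) => a b c dab E.
have [phi [phiD phiZ phi1 phi0]] := vertex_functional F ns (ksrc a).
have phi00 : phi 0 = 0 by rewrite -(scale0r (0 : K)) phiZ mul0r.
suff -> : c = 0 by rewrite scale0r.
rewrite -[c]mulr1 -phi1 -phiZ -E -{}phi00 -(nu_mul0r (spath b)) -(nu_mulr0 (sghost a)) -y0.
rewrite nu_mul_sumr nu_mul_suml (bigD1_seq _ si us)/= phiD.
apply/esym; rewrite -[RHS]addr0; congr (_ + _).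
rewrite big_seq_cond; apply: (big_ind (fun z => phi z = 0)).
- by rewrite -(scale0r (0 : K)) phiZ mul0r.
- by move=> z w z0 w0; rewrite phiD z0 w0 addr0.
- move=> j /andP[sj ji]; apply: (phi0 (d j - d i)).
    by rewrite subr_eq0 (inj_eq dinj).
  rewrite (_ : d j - d i = - degZ (kdeg a) + d j + degZ (kdeg b)).
    apply: kph_mul; last exact: spath_homog.
    by apply: kph_mul; [exact: sghost_homog|exact: yh].
  by rewrite -dab opprB addrA addrAC [- _ + _]addrC.
Qed.

(** Degrees may repeat, so that closure under sums and products is immediate; [homog_sum_decomp]
    merges equal degrees afterwards. *)
Inductive homog_sum (I : set K) : K -> Prop :=
  | homog_sum0 : homog_sum I 0
  | homog_sum_add n x y : I x -> kp_homog n x -> homog_sum I y ->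
      homog_sum I (x + y).

Lemma homog_sum1 I n x : I x -> kp_homog n x -> homog_sum I x.
Proof.
move=> Ix xn; rewrite -[x]addr0.
by apply: homog_sum_add xn _ => //; exact: homog_sum0.
Qed.

Lemma homog_sumD I x y : homog_sum I x -> homog_sum I y -> homog_sum I (x + y).
Proof.
move=> + hy; elim=> [|n z w Iz zn _]; first by rewrite add0r.
by rewrite -addrA; exact: homog_sum_add zn.
Qed.

(** Three sets, so that one factor may range over the whole algebra while the other stays in an
    ideal. *)
Lemma homog_sumM (I1 I2 I : set K) x y : (forall u w, I1 u -> I2 w -> I (u ** w)) ->
  homog_sum I1 x -> homog_sum I2 y -> homog_sum I (x ** y).
Proof.
move=> I12 hx hy; elim: hx => [|n z w Iz zn _ IHw].
  by rewrite nu_mul0r; exact: homog_sum0.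
rewrite nu_mulDl; apply: homog_sumD => // {IHw}.
elim: hy => [|m u v Iu um _ IHv]; first by rewrite nu_mulr0; exact: homog_sum0.
rewrite nu_mulDr; apply: homog_sumD => //.
by apply: homog_sum1 (kph_mul zn um); exact: I12.
Qed.

Lemma homog_sumZ I c x : nuideal I -> homog_sum I x -> homog_sum I (c *: x).
Proof.
move=> hI; elim=> [|n z w Iz zn _ IHw]; first by rewrite scaler0; exact: homog_sum0.
rewrite scalerDr; apply: homog_sum_add IHw; first exact: nui_scale.
exact: kph_scale zn.
Qed.

Lemma homog_sum_decomp (I : set K) x : nuideal I -> homog_sum I x ->
  exists (s : seq 'rV[int]_k) (y : 'rV[int]_k -> K),
    [/\ uniq s, forall n, n \in s -> (I `&` kp_homog n) (y n)
      & x = \sum_(n <- s) y n].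
Proof.
move=> hI; elim=> [|n z w Iz zn _ [s [y [us sy ->]]]].
  by exists [::], (fun=> 0); rewrite big_nil.
have [ns'|ns'] := boolP (n \in s).
  exists s, (fun m => if m == n then z + y m else y m); split=> // [m ms|].
    have [Iy ym] := sy m ms; case: eqVneq => [mn|//]; subst m.
    by split; [exact: nui_add|exact: kph_add].
  rewrite !(bigD1_seq _ ns' us)/= eqxx addrA; congr (_ + _).
  by apply: eq_bigr => m /negPf ->.
exists (n :: s), (fun m => if m == n then z else y m); split.
- by rewrite /= ns'.
- move=> m; rewrite inE; case: eqVneq => [-> _|_ /=]; first by [].
  exact: sy.
- rewrite big_cons eqxx; congr (_ + _); apply: eq_big_seq => m ms.
  by case: eqVneq => // mn; rewrite -mn ms in ns'.
Qed.

Lemma homog_sum_all (x : K) : homog_sum setT x.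
Proof.
have hT : nuideal (setT : set K) by [].
rewrite -(kpi_repr (x : kpq F L)); elim: (repr (x : kpq F L)) => {x}.
- by move=> v; exact: homog_sum1 (kph_vertex F v).
- by move=> a; exact: homog_sum1 (kph_path F a).
- by move=> a; exact: homog_sum1 (kph_ghost F a).
- exact: homog_sum0.
- move=> t ht; rewrite (_ : kpi _ = - 1 *: (kpi t : K)); first exact: homog_sumZ.
  by rewrite scaleN1r; apply/esym; exact: kpi_opp.
- by move=> t ht u hu; rewrite -kpi_addE; exact: homog_sumD.
- by move=> c t ht; rewrite -kpi_scaleE; exact: homog_sumZ.
- by move=> t ht u hu; rewrite -kpi_mulE; exact: homog_sumM ht hu.
Qed.

(** * Graded ideals and the vertices they contain *)

Lemma graded_byP (I : set K) : nuideal I -> (forall x, I x -> homog_sum I x) ->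
  graded_by (@kp_homog F k L) I.
Proof.
move=> hI Ih; split=> [x|s y us sy y0].
  split=> [/Ih|[s [y [_ sy ->]]]]; first exact: homog_sum_decomp.
  rewrite big_seq; apply: (big_ind I); [exact: nui_zero|exact: nui_add|].
  by move=> n /sy[].
by apply: (@homog_independent _ s id y us (@inj_id _)) y0 => n /sy[].
Qed.

Lemma vertex_ideal_ideal H : nuideal (vertex_ideal F (L:=L) H).
Proof. exact: ideal_gen_ideal. Qed.

Lemma vertex_idealP (H : set (kvertex L)) v : H v -> vertex_ideal F H (pv v).
Proof. by move=> Hv I _; apply; exists v. Qed.

Lemma vertex_idealS (H H' : set (kvertex L)) : H `<=` H' ->
  vertex_ideal F H `<=` vertex_ideal F H'.
Proof.
move=> HH' x; apply; first exact: vertex_ideal_ideal.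
by move=> _ [v Hv <-]; apply: vertex_idealP; exact: HH'.
Qed.

Lemma vertex_ideal_graded (H : set (kvertex L)) :
  graded_by (@kp_homog F k L) (vertex_ideal F H).
Proof.
have hI := vertex_ideal_ideal H; apply: graded_byP => // x Ix.
(* The sums of homogeneous elements of I(H) form an ideal containing the generators, so minimality
   of I(H) applies. *)
apply: (Ix (homog_sum (vertex_ideal F H))).
  split=> [|y z|c y|a y hy|a y hy].
  - exact: homog_sum0.
  - exact: homog_sumD.
  - exact: homog_sumZ.
  - by apply: homog_sumM (homog_sum_all a) hy => u w _ Iw; exact: (nui_mull hI).
  - by apply: homog_sumM hy (homog_sum_all a) => u w Iu _; exact: (nui_mulr hI).
by move=> _ [v Hv <-]; apply: homog_sum1 (kph_vertex F v); exact: vertex_idealP.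
Qed.

Definition ideal_vertices (I : set K) : set (kvertex L) := [set v | I (pv v)].

(** The vertex at the source of a is s_a^* p s_a, with p the vertex at its range. *)
Lemma ideal_vertices_hereditary I : nuideal I -> hereditary (ideal_vertices I).
Proof.
move=> hI a Ia; rewrite /ideal_vertices /=.
have := sghost_spath (erefl (kdeg a)); rewrite eqxx => <-.
by rewrite -(vertex_spath a) nu_mulA; apply: nui_mulr => //; exact: nui_mull.
Qed.

Lemma graded_ideal_vertices I : nuideal I -> graded_by (@kp_homog F k L) I ->
  I = vertex_ideal F (ideal_vertices I).
Proof.
move=> hI [Igr _]; apply/seteqP; split=> x; last first.
  by apply=> // _ [v Iv <-].
move=> /Igr[s [y [_ sy ->]]].
have hJ := vertex_ideal_ideal (ideal_vertices I).
rewrite big_seq; apply: (big_ind (vertex_ideal F (ideal_vertices I))).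
- exact: (nui_zero hJ).
- exact: (nui_add hJ).
- move=> n /sy[Iy yn]; apply: (homog_in_ideal hJ yn) => a b c _ E.
  (* A nonzero cut lies in I, and dividing by c puts the vertex itself in I. *)
  have [->|c0] := eqVneq c 0; first by rewrite scale0r; exact: (nui_zero hJ).
  apply: (nui_scale hJ); apply: vertex_idealP; rewrite /ideal_vertices /=.
  rewrite -[pv _]scale1r -(mulVf c0) -scalerA -E; apply: (nui_scale hI).
  by apply: (nui_mulr hI); exact: (nui_mull hI).
Qed.

(** * Annihilators and the regular graded ideals *)

Lemma annihilator_graded I : nuideal I -> graded_by (@kp_homog F k L) I ->
  graded_by (@kp_homog F k L) (annihilator I).
Proof.
move=> hI [Igr _]; have hJ := annihilator_ideal hI; apply: graded_byP => // x Jx.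
have hT : nuideal (setT : set K) by [].
have [s [y [us sy xE]]] := homog_sum_decomp hT (homog_sum_all x).
rewrite xE big_seq; apply: (big_ind (homog_sum (annihilator I))).
- exact: homog_sum0.
- by move=> *; exact: homog_sumD.
move=> n ns'; have [_ yn] := sy n ns'; apply: homog_sum1 yn => a /Igr[s' [z [_ sz ->]]].
(* For fixed m the products of the components [y n] of x with [z m] have distinct degrees n + m and
   add up to the product of x with [z m], which is 0; so each vanishes. *)
rewrite nu_mul_suml nu_mul_sumr; split; rewrite big_seq big1// => m /sz[Iz zm].
- apply: (@homog_independent _ s (fun n => n + m) (fun n => y n ** z m)) ns' => //.
  + exact: addIr.
  + by move=> i /sy[_ yi]; exact: kph_mul.
  + by rewrite -nu_mul_suml -xE; case: (Jx _ Iz).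
- apply: (@homog_independent _ s (fun n => m + n) (fun n => z m ** y n)) ns' => //.
  + by move=> i /sy[_ yi]; exact: kph_mul.
  + by rewrite -nu_mul_sumr -xE; case: (Jx _ Iz).
Qed.

(** A nonzero scalar cut would produce paths from v and from w with a common source. That source is
    in H by heredity along the path from w, against the choice of v. *)
Lemma vertex_mul_perp H v w (x : K) : hereditary H -> vperp H v -> H w ->
  pv v ** x ** pv w = 0 /\ pv w ** x ** pv v = 0.
Proof.
move=> hH vH Hw; elim: (homog_sum_all x) => [|n y z _ yn _ [IH1 IH2]].
  by rewrite !(nu_mulr0, nu_mul0r).
rewrite !(nu_mulDr, nu_mulDl) IH1 IH2 !addr0.
have h1 := kph_mul (kph_mul (kph_vertex F v) yn) (kph_vertex F w).
have h2 := kph_mul (kph_mul (kph_vertex F w) yn) (kph_vertex F v).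
have ends (u t : kvertex L) (a b : kpath L) c :
    sghost a ** (pv u ** y ** pv t) ** spath b = c *: pv (ksrc a) ->
    c *: pv (ksrc a) = 0 \/ [/\ krng a = u, krng b = t & ksrc a = ksrc b].
  move=> E; have [au|/eqP au] := eqVneq (krng a) u; last first.
    by left; rewrite -E !nu_mulA sghost_vertex_orth// !nu_mul0r.
  have [bt|/eqP bt] := eqVneq t (krng b); last first.
    by left; rewrite -E -!nu_mulA vertex_spath_orth// !nu_mulr0.
  have [ab|/eqP ab] := eqVneq (ksrc a) (ksrc b); first by right.
  left; rewrite -E -(spath_vertex b) nu_mulA E -nu_scaleAl vertex_orth//.
  exact: scaler0.
split; [apply: (homog_in_ideal (@nuideal0 F K) h1)|apply: (homog_in_ideal (@nuideal0 F K) h2)];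
  move=> a b c _ /ends[//|[au bt ab]] /=.
- by case: (vH a au); rewrite ab; apply: hH; rewrite bt.
- by case: (vH b bt); rewrite -ab; apply: hH; rewrite au.
Qed.

Lemma ideal_vertices_annihilator (H : set (kvertex L)) : hereditary H ->
  ideal_vertices (annihilator (vertex_ideal F H)) = vperp H.
Proof.
move=> hH; apply/seteqP; split=> v.
- move=> Jv a av Ha.
  have [] : _ /\ _ := Jv (spath a) _.
    rewrite -(spath_vertex a); apply: nui_mull (vertex_ideal_ideal H) _ _ _.
    exact: vertex_idealP.
  rewrite -av vertex_spath => a0 _; apply: (@vertex_neq0 (ksrc a)).
  by have := sghost_spath (erefl (kdeg a)); rewrite eqxx => <-; rewrite a0 nu_mulr0.
- move=> vH x Ix.
  (* The factor y in between makes the condition on x define an ideal, so it need only be checked on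
     generators; taking a local unit for y then removes it. *)
  suff vx y : pv v ** y ** x = 0 /\ x ** y ** pv v = 0.
    have [s _ [sx xs]] := local_unit x; have [e1 e2] := vx (vunit s).
    by rewrite -nu_mulA sx in e1; rewrite xs in e2.
  apply: (Ix [set x | forall y, pv v ** y ** x = 0 /\ x ** y ** pv v = 0]) y.
    split=> [y|y z Iy Iz u|c y Iy u|a y Iy u|a y Iy u].
    + by rewrite !nu_mulr0 !nu_mul0r.
    + have [e1 e2] := Iy u; have [e3 e4] := Iz u.
      by rewrite nu_mulDr !nu_mulDl e1 e2 e3 e4 addr0.
    + have [e1 e2] := Iy u.
      by rewrite -nu_scaleAr -!nu_scaleAl e1 e2 scaler0.
    + have [e1 _] := Iy (u ** a); have [_ e2] := Iy u.
      split; first by rewrite nu_mulA -[pv v ** u ** a]nu_mulA e1.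
      by rewrite -!nu_mulA [y ** _]nu_mulA e2 nu_mulr0.
    + have [e1 _] := Iy u; have [_ e2] := Iy (a ** u).
      by rewrite nu_mulA e1 nu_mul0r -[y ** a ** u]nu_mulA e2.
  by move=> _ [w Hw <-] y; exact: (vertex_mul_perp y hH vH Hw).
Qed.

Lemma annihilator_vertex_ideal (H : set (kvertex L)) : hereditary H ->
  annihilator (vertex_ideal F H) = vertex_ideal F (vperp H).
Proof.
move=> hH; have hI := vertex_ideal_ideal H; rewrite -ideal_vertices_annihilator//.
apply: graded_ideal_vertices; first exact: annihilator_ideal.
by apply: annihilator_graded => //; exact: vertex_ideal_graded.
Qed.

Lemma vertex_ideal_regGr (H : set (kvertex L)) : RegV H -> RegGr F L (vertex_ideal F H).
Proof.
move=> rH; split; [exact: vertex_ideal_ideal|exact: vertex_ideal_graded|].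
rewrite annihilator_vertex_ideal; last exact: reg_hereditary.
by rewrite annihilator_vertex_ideal -?rH//; exact: vperp_hereditary.
Qed.

(** To reflect inclusions, pass to annihilators, whose vertices are known, and apply [vperp] once
    more. *)
Lemma vertex_ideal_le (H H' : set (kvertex L)) : RegV H -> RegV H' ->
  H `<=` H' <-> vertex_ideal F H `<=` vertex_ideal F H'.
Proof.
move=> rH rH'; split; first exact: vertex_idealS.
move=> /annihilatorS II'; rewrite rH rH'; apply: vperpS.
rewrite -!ideal_vertices_annihilator; [|exact: reg_hereditary..].
by move=> v; exact: II'.
Qed.

Lemma regGr_boolean_iso : boolean_iso (@RegV k L) (RegGr F L) (@vertex_ideal F k L).
Proof.
apply: boolean_transport; [exact: regV_boolean| |exact: vertex_ideal_le].
split; first exact: vertex_ideal_regGr.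
- move=> H H'; rewrite !inE => rH rH' E.
  by apply/seteqP; split; apply/vertex_ideal_le; rewrite ?E.
- move=> I [hI gI rI]; exists (ideal_vertices I); last by rewrite -graded_ideal_vertices.
  have hV := ideal_vertices_hereditary hI.
  apply/seteqP; split; first exact: sub_vperp2.
  (* Regularity of I shows that it contains every vertex of the double perp of its vertex set. *)
  suff E : I = vertex_ideal F (vperp (vperp (ideal_vertices I))).
    by move=> v vV; rewrite /ideal_vertices /= E; exact: vertex_idealP.
  rewrite {1}rI {1}(graded_ideal_vertices hI gI) annihilator_vertex_ideal//.
  by rewrite annihilator_vertex_ideal//; exact: vperp_hereditary.
Qed.

End KumjianPaskTheory.

(** * Both sides joined through the regular vertex sets *)

Lemma regular_ideals_iso (F : fieldType) k (L : kgraph k) :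
  row_finite L -> without_sources L ->
  boolean_iso (RegZ (talented_monoid L)) (RegGr F L)
    (fun J => vertex_ideal F (hvertices J)).
Proof.
move=> rf ns; apply: boolean_iso_comp (regGr_boolean_iso F rf ns).
apply: boolean_iso_can (regZ_boolean_iso rf ns) _ => H rH.
by apply: hvertices_tideal; [exact: reg_hereditary|exact: reg_saturated].
Qed.

Theorem theorem6p2 (F : fieldType) (k : nat) (hk : (0 < k)%N) :
  (forall L : kgraph k, row_finite L -> without_sources L ->
     boolean_iso (RegZ (talented_monoid L)) (RegGr F L)
       (fun J => vertex_ideal F (hvertices J)))
  /\
  (forall L O : kgraph k,
     row_finite L -> without_sources L ->
     row_finite O -> without_sources O ->
     zmonoid_iso (talented_monoid L) (talented_monoid O) ->
     exists f, boolean_iso (RegGr F L) (RegGr F O) f).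
Proof.
split=> [L|L O rfL nsL rfO nsO LO]; first exact: regular_ideals_iso.
have isoL := regular_ideals_iso F rfL nsL; have isoO := regular_ideals_iso F rfO nsO.
have [LB _ _ _] := isoL; have [f fiso] := regZ_zmonoid_iso LB LO.
have [g giso] := boolean_iso_sym isoL.
by eexists; apply: boolean_iso_comp giso (boolean_iso_comp fiso isoO).
Qed.
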